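(* For integers $m\ge 2$ and $n\ge 1$, let $G_{n,m}$ be a random variable with probability generating function $\mathbb{E}\,q^{G_{n,m}} = m^{-n} G_n^{(m)}(q)$, and let \[ \mu_{n,m}=\frac{n(n-1)}{4}\cdot\frac{m-1}{m},\qquad \sigma^2_{n,m}=\frac{n(n-1)(2n+5)}{72}\cdot\frac{m^2-1}{m^2} \] (these are the mean and variance of $G_{n,m}$), with $\sigma_{n,m}>0$ the positive square root. Then, as $n\to\infty$, \[ \sigma_{n,m}\,\mathbb{P}(G_{n,m}=k)=\frac{1}{\sqrt{2\pi}}e^{-(k-\mu_{n,m})^2/(2\sigma^2_{n,m})}+o(1), \] uniformly in all integers $m\ge2$ and $k\in\mathbb{Z}$. The same statement holds with $\mu_{n,m}$ and $\sigma^2_{n,m}$ replaced by $\bar\mu_{n,m}=\frac{m-1}{4m}n^2$ and $\bar\sigma^2_{n,m}=\frac{m^2-1}{36m^2}n^3$ (both on the left and on the right side).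
   Context: For $\ell\ge1$, $[\ell]_q=(1-q^\ell)/(1-q)$, $[k]!_q=[1]_q\cdots[k]_q$ (with $[0]!_q=1$), and for nonnegative integers $k_1+\dots+k_m=n$, $\binom{n}{k_1,\dots,k_m}_q=\frac{[n]!_q}{[k_1]!_q\cdots[k_m]!_q}$. The generalized Galois number is $G_n^{(m)}(q)=\sum_{k_1+\dots+k_m=n}\binom{n}{k_1,\dots,k_m}_q$, a polynomial in $q$ with nonnegative coefficients and $G_n^{(m)}(1)=m^n$. *)

(* Defs.v *)
From HB Require Import structures.
From mathcomp Require Import all_boot all_order all_algebra.
From mathcomp Require Import all_classical all_reals all_analysis.

Set Implicit Arguments.
Unset Strict Implicit.
Unset Printing Implicit Defensive.

Import Order.TTheory GRing.Theory Num.Theory.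

Local Open Scope ring_scope.

Section QAnalogues.
Context {R : fieldType}.

(* The indeterminate 'X plays the role of q.  The quotients [%/] below are
   Euclidean, but all of them are exact: see [qintM] and [qmultinomialM]. *)
Definition qint (l : nat) : {poly R} := (1 - 'X^l) %/ (1 - 'X).

Definition qfact (n : nat) : {poly R} := \prod_(1 <= l < n.+1) qint l.

Definition qmultinomial (n m : nat) (k : 'I_m -> nat) : {poly R} :=
  qfact n %/ \prod_(i < m) qfact (k i).

(* A part of a weak composition of n is at most n, hence lies in 'I_n.+1. *)
Definition galois_poly (n m : nat) : {poly R} :=
  \sum_(k : {ffun 'I_m -> 'I_n.+1} | (\sum_(i < m) k i)%N == n)
    qmultinomial n (fun i => k i).

Lemma subr1X_neq0 : 1 - 'X != 0 :> {poly R}.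
Proof. by rewrite -opprB oppr_eq0 polyXsubC_eq0. Qed.

Lemma qintE l : qint l = \sum_(i < l) 'X^i.
Proof.
by rewrite /qint -{1}(expr1n _ l) subrXX (eq_bigr (fun i : 'I_l => 'X^i)) ?mulKp
  ?subr1X_neq0 // => i _; rewrite expr1n mul1r.
Qed.

Lemma qintM l : qint l * (1 - 'X) = 1 - 'X^l.
Proof.
rewrite qintE mulrC -{2}(expr1n _ l) subrXX; congr (_ * _).
by apply: eq_bigr => i _; rewrite expr1n mul1r.
Qed.

Lemma qintD a b : qint (a + b) = qint a + 'X^a * qint b.
Proof.
apply: (mulIf subr1X_neq0); rewrite mulrDl -mulrA !qintM exprD.
by rewrite mulrBr mulr1 addrA subrK.
Qed.

Lemma qfactS n : qfact n.+1 = qfact n * qint n.+1.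
Proof. by rewrite /qfact big_nat_recr. Qed.

Lemma qfact_neq0 n : qfact n != 0.
Proof.
elim: n => [|n IHn]; first by rewrite /qfact big_geq ?oner_neq0.
rewrite qfactS mulf_neq0 //; apply: contraTneq (oner_neq0 {poly R}) => q0.
have := qintM n.+1; rewrite q0 mul0r => /(congr1 (coefp 0)) /eqP.
by rewrite /= coefB coefXn coef0 coef1 subr0 eq_sym oner_eq0.
Qed.

Lemma dvdp_qfactD a b : qfact a * qfact b %| qfact (a + b).
Proof.
have qfact0 : qfact 0 = 1 by rewrite /qfact big_geq.
have [n] := ubnP (a + b); elim: n a b => // n IHn [|a] [|b] ltn;
  rewrite ?addn0 ?add0n ?qfact0 ?mul1r ?mulr1 ?dvdpp //.
have -> : qfact (a.+1 + b.+1) =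
    qfact (a + b.+1) * qint a.+1 + qfact (a.+1 + b) * ('X^(a.+1) * qint b.+1).
  by rewrite {1}addSn qfactS -addSn qintD mulrDr -addSnnS.
rewrite dvdp_add //.
  by rewrite (qfactS a) mulrAC dvdp_mul // IHn.
by rewrite (qfactS b) mulrA dvdp_mul ?dvdp_mull // IHn // addSnnS.
Qed.

Lemma qmultinomialM n m (k : 'I_m -> nat) : (\sum_(i < m) k i)%N = n ->
  qmultinomial n k * \prod_(i < m) qfact (k i) = qfact n.
Proof.
move=> <-; apply: divpK.
elim/big_ind2: _ => [|a p b r ha hb|//]; first exact: dvd1p.
exact: dvdp_trans (dvdp_mul ha hb) (dvdp_qfactD _ _).
Qed.

End QAnalogues.

Arguments galois_poly R n m : clear implicits.

Section LocalLimit.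
Context {R : realType}.

Definition has_pgf d (T : measurableType d) (P : probability T R)
    (X : {RV P >-> nat}) (g : {poly R}) : Prop :=
  forall q : R, 0 <= q <= 1 -> 'E_P[fun w => (q ^+ X w)%R]%E = g.[q]%:E.

Definition galois_mean (n m : nat) : R :=
  n%:R * (n%:R - 1) / 4 * ((m%:R - 1) / m%:R).

Definition galois_var (n m : nat) : R :=
  n%:R * (n%:R - 1) * (2 * n%:R + 5) / 72 * ((m%:R ^+ 2 - 1) / m%:R ^+ 2).

Definition galois_mean_bar (n m : nat) : R :=
  (m%:R - 1) / (4 * m%:R) * n%:R ^+ 2.

Definition galois_var_bar (n m : nat) : R :=
  (m%:R ^+ 2 - 1) / (36 * m%:R ^+ 2) * n%:R ^+ 3.

(* [p n m k] stands for P(G_{n,m} = k). *)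
Definition uniform_local_limit (p : nat -> nat -> int -> R)
    (mu sigma2 : nat -> nat -> R) : Prop :=
  forall eps : R, 0 < eps ->
  exists N : nat, forall (n m : nat) (k : int), (N <= n)%N -> (2 <= m)%N ->
    `| Num.sqrt (sigma2 n m) * p n m k
       - (Num.sqrt (2 * pi))^-1
         * expR (- (k%:~R - mu n m) ^+ 2 / (2 * sigma2 n m)) | < eps.

End LocalLimit.

(* Main.v *)
(* G_{n,m} is the number of inversions of a uniform random word w of length n
   over m letters: this is MacMahon's formula, q-multinomial by q-multinomial.
   Let u be the content of w (the number of occurrences of each letter).  Given
   u, the characteristic function at t = 2x is a phase times the real number
   \prod_(j <= n) sinc(j x) / \prod_i \prod_(j <= u_i) sinc(j x).

   The function g(y) = sin y / y * exp(y^2/6) is nonincreasing on (0, pi] and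
   1 - y^4/36 <= g(y) <= 1.  Hence, for n x < pi, the quotient above is
   exp(- x^2 D(u) / 6) up to a relative error n^5 x^4, where D(u) is the sum of
   the squares up to n minus the sums of the squares up to each u_i.  As the u_i
   average to n/m with \sum_i (u_i - n/m)^2 of expectation at most n, this gives
   the Gaussian approximation on the scale x ~ n^(-3/2), uniformly in m.

   Moreover D(u) >= n^2 S / 3 when S disjoint pairs of positions carry distinct
   letters, which gives a bound exp(- c n^3 x^2) for n x <= 1/2.  For larger x,
   cut the word into blocks of length of order 1/x: given the contents of the
   blocks, the inversions inside the blocks are independent and those between
   the blocks are determined, so the block bounds multiply to exp(- c n).
   Fourier inversion concludes. *)
Require Import Defs.
From HB Require Import structures.
From mathcomp Require Import all_boot all_order all_algebra.
From mathcomp Require Import all_classical all_reals all_analysis.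
From mathcomp Require Import measurable_realfun gauss_integral.
From mathcomp Require Import zify ring lra.

Set Implicit Arguments.
Unset Strict Implicit.
Unset Printing Implicit Defensive.

Import Order.TTheory GRing.Theory Num.Theory.
Import numFieldNormedType.Exports.

Local Open Scope classical_set_scope.
Local Open Scope ring_scope.

(** * Words and MacMahon's formula *)

Section Words.
Context {m : nat}.
Implicit Types (w : seq 'I_m) (u : {ffun 'I_m -> nat}) (a i : 'I_m) (n : nat).

(** Uniformity in m is the obstacle: the number of letters is unbounded, so no error may be paid per
    letter. The monotonicity of g settles this, because it compares the numerator with the whole
    denominator factor by factor, whatever the content. The decay bounds are uniform because two
    random letters differ with probability at least 1/2, the worst case being m = 2.

    The blocks are forced by the condition n x < pi: beyond it sines in the denominator may vanish,
    and the quotient gives no information.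

    The natural Gaussian limit has the barred parameters: they are what the phase and the leading
    part of D(u) become at u_i = n/m. The exact mean and variance differ from them by at most n and
    n^2, which is negligible against the scales n^(3/2) and n^3. A single estimate, valid for all
    parameters within these tolerances, therefore gives both statements. *)

Fixpoint words n : seq (seq 'I_m) :=
  if n is n'.+1 then [seq a :: w | a <- enum 'I_m, w <- words n'] else [:: [::]].

Definition smaller a w : nat := count (fun b : 'I_m => (b < a)%N) w.

Fixpoint inversions w : nat :=
  if w is a :: w' then (smaller a w' + inversions w')%N else 0%N.

Definition content w : {ffun 'I_m -> nat} := [ffun i => count_mem i w].

Definition below u (j : nat) : nat := \sum_(i < m | (i < j)%N) u i.

(** The subtraction is truncated: if [u a] is 0 this is [u] itself, hence the guard [0 < u a] in the
    recursion on contents. *)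
Definition remove a u : {ffun 'I_m -> nat} := [ffun i => (u i - (i == a))%N].

Lemma sum_words_cons (V : nmodType) n (F : seq 'I_m -> V) :
  \sum_(w <- words n.+1) F w = \sum_(a < m) \sum_(w <- words n) F (a :: w).
Proof. by rewrite /= big_allpairs_dep big_enum. Qed.

Lemma sum_words0 (V : nmodType) (F : seq 'I_m -> V) :
  \sum_(w <- words 0) F w = F [::].
Proof. by rewrite big_seq1. Qed.

Lemma sum_words_cat (V : nmodType) n1 n2 (F : seq 'I_m -> V) :
  \sum_(w <- words (n1 + n2)) F w =
  \sum_(w1 <- words n1) \sum_(w2 <- words n2) F (w1 ++ w2).
Proof.
elim: n1 F => [|n1 IHn] F; first by rewrite sum_words0.
rewrite addSn !sum_words_cons; apply: eq_bigr => a _.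
by rewrite (IHn (fun w => F (a :: w))).
Qed.

Lemma size_words n w : w \in words n -> size w = n.
Proof.
elim: n w => [|n IHn] w /=; first by rewrite inE => /eqP ->.
by case/allpairsP => -[a w'] /= [_ /IHn <- ->].
Qed.

Lemma sum_content w : (\sum_(i < m) content w i)%N = size w.
Proof.
elim: w => [|a w IHw]; first by rewrite big1 // => i _; rewrite ffunE.
rewrite /= -IHw -add1n; under eq_bigr do rewrite ffunE /=.
rewrite big_split /=; congr addn; last by apply: eq_bigr => i _; rewrite ffunE.
by rewrite (bigD1 a) //= eqxx big1 // => i; rewrite eq_sym => /negPf ->.
Qed.

Lemma content_cons a w i : content (a :: w) i = ((i == a) + content w i)%N.
Proof. by rewrite !ffunE /= eq_sym. Qed.

Lemma content_cat w1 w2 :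
  content (w1 ++ w2) = [ffun i => (content w1 i + content w2 i)%N].
Proof. by apply/ffunP => i; rewrite !ffunE count_cat. Qed.

Lemma smallerE a w : smaller a w = below (content w) a.
Proof.
elim: w => [|b w IHw]; first by rewrite /below big1 // => i _; rewrite ffunE.
rewrite /smaller /= -/(smaller a w) IHw /below.
under [RHS]eq_bigr do rewrite content_cons.
rewrite big_split /=; congr addn; case: (ltnP b a) => ba.
  by rewrite (bigD1 b) //= eqxx big1 // => i /andP[_ /negPf ->].
by rewrite big1 // => i ia; case: eqP => // ib; rewrite ib ltnNge ba in ia.
Qed.

Lemma below_remove a u : below (remove a u) a = below u a.
Proof.
apply: eq_bigr => i; rewrite ffunE; case: eqP => [->|]; first by rewrite ltnn.
by rewrite subn0.
Qed.

Lemma inversions_cat w1 w2 :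
  inversions (w1 ++ w2) =
  (inversions w1 + inversions w2
   + \sum_(i < m) content w1 i * below (content w2) i)%N.
Proof.
elim: w1 => [|a w1 IHw] /=.
  by rewrite add0n big1 ?addn0 // => i _; rewrite ffunE.
under eq_bigr do rewrite content_cons mulnDl.
rewrite IHw {1}/smaller count_cat -!/(smaller _ _) (smallerE a w2) big_split /=.
have -> : (\sum_(i < m) (i == a) * below (content w2) i)%N = below (content w2) a.
  by rewrite (bigD1 a) //= eqxx mul1n big1 ?addn0 // => i /negPf ->.
by ring.
Qed.

Lemma content_cons_eq a w u : (content (a :: w) == u) =
  (0 < u a)%N && (content w == remove a u).
Proof.
apply/eqP/andP => [<-|[ua /eqP wu]].
  rewrite content_cons eqxx; split=> //; apply/eqP/ffunP => i.
  by rewrite [RHS]ffunE content_cons addKn.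
apply/ffunP => i; rewrite content_cons wu ffunE.
by case: (i =P a) => [->|_]; rewrite ?subnKC // subn0.
Qed.

Lemma sum_remove a u : (0 < u a)%N ->
  (\sum_(i < m) remove a u i).+1 = (\sum_(i < m) u i)%N.
Proof.
move=> ua; rewrite (bigD1 a) //= [RHS](bigD1 a) //= ffunE eqxx -addSn subn1 prednK //.
by congr addn; apply: eq_bigr => i /negPf ia; rewrite ffunE ia subn0.
Qed.

(** When [a] heads a word of content [u], it creates [below u a] inversions whatever the order of
    the other letters. Both forms of MacMahon's formula are inductions along this recursion. *)
Lemma sum_words_content_cons (V : nmodType) n u (F : nat -> V) :
  \sum_(w <- words n.+1 | content w == u) F (inversions w) =
  \sum_(a < m | (0 < u a)%N) \sum_(w <- words n | content w == remove a u)
    F (below u a + inversions w)%N.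
Proof.
rewrite big_mkcond sum_words_cons [RHS]big_mkcond; apply: eq_bigr => a _.
under eq_bigr do rewrite content_cons_eq.
case: (0 < u a)%N; last by rewrite big1.
rewrite -big_mkcond; apply: eq_bigr => w /eqP wu /=.
by rewrite smallerE wu below_remove.
Qed.

(** The intervals from [below u a] to [below u a + u a] tile the segment from 0 to the total of [u].
    With [f] the q-integers this is the q-Pascal rule for multinomials. *)
Lemma sum_below_telescope (V : zmodType) u (f : nat -> V) :
  \sum_(a < m) (f (below u a + u a)%N - f (below u a)) =
  f (\sum_(a < m) u a)%N - f 0%N.
Proof.
have belowS a : below u a.+1 = (below u a + u a)%N.
  rewrite /below addnC (bigD1 a) //=; congr addn; apply: eq_bigl => i.
  by rewrite ltnS (ltn_neqAle i a) andbC.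
under eq_bigr do rewrite -belowS.
rewrite -(big_mkord xpredT (fun j : nat => f (below u j.+1) - f (below u j))).
rewrite telescope_sumr // /below; congr (f _ - f _); last by rewrite big_pred0.
by apply: eq_bigl => i; rewrite ltn_ord.
Qed.

Lemma prod_remove (A : comPzSemiRingType) (f : nat -> A) a u : (0 < u a)%N ->
  \prod_(i < m) \prod_(j < u i) f j =
  f (u a).-1 * \prod_(i < m) \prod_(j < remove a u i) f j.
Proof.
move=> ua; rewrite (bigD1 a) //= [in RHS](bigD1 a) //= ffunE eqxx subn1.
have -> : \prod_(j < u a) f j = \prod_(j < (u a).-1) f j * f (u a).-1.
  by case: (u a) ua => // k _; rewrite big_ord_recr.
rewrite mulrCA mulrA; congr (_ * _).
by apply: eq_bigr => i /negPf ia; rewrite ffunE ia subn0.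
Qed.

End Words.
Arguments words m n : clear implicits.

Section MacMahon.
Context {K : fieldType} {m : nat}.
Implicit Types (u : {ffun 'I_m -> nat}) (n : nat).

Lemma qfactE n : qfact n = \prod_(j < n) qint j.+1 :> {poly K}.
Proof. by rewrite /qfact big_add1 big_mkord. Qed.

(** Stated without division, so that the induction stays among polynomials. Removing the first
    letter [a] leaves a factor q^(below u a) [u a]_q, a difference of two q-integers, and these
    differences telescope to [n]_q. *)
Lemma macmahon n u : (\sum_(i < m) u i)%N = n ->
  (\sum_(w <- words m n | content w == u) 'X^(inversions w))
    * \prod_(i < m) qfact (u i) = qfact n :> {poly K}.
Proof.
rewrite (eq_bigr (fun i => \prod_(j < u i) qint j.+1)) => [|i _]; last exact: qfactE.
elim: n u => [|n IHn] u un.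
  have u0 i : u i = 0%N.
    by apply/eqP; have /eqP := un; rewrite sum_nat_eq0 => /forallP /(_ i).
  rewrite [X in _ * X]big1 => [|i _]; last by rewrite u0 big_ord0.
  rewrite mulr1 big_mkcond sum_words0 /= expr0 /qfact big_geq //.
  by rewrite (_ : content [::] == u) //; apply/eqP/ffunP => i; rewrite ffunE u0.
rewrite sum_words_content_cons mulr_suml qfactS -un.
transitivity (\sum_(a < m) qfact n *
    (qint (below u a + u a) - qint (below u a)) : {poly K}); last first.
  rewrite -mulr_sumr sum_below_telescope [qint 0]qintE big_ord0 subr0.
  by rewrite un.
rewrite big_mkcond; apply: eq_bigr => a _; case: posnP => [-> | ua].
  by rewrite addn0 subrr mulr0.
rewrite qintD addrAC subrr add0r.
rewrite (eq_bigr (fun w => 'X^(below u a) * 'X^(inversions w))) => [|w _]; last exact: exprD.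
rewrite -mulr_sumr (prod_remove (fun j => qint j.+1) ua) prednK //.
have /IHn <- : (\sum_(i < m) remove a u i)%N = n.
  by apply/eqP; rewrite -eqSS sum_remove ?un.
by ring.
Qed.

(** Words are grouped by content. Bounding the parts by n loses nothing, since no letter occurs more
    than n times. *)
Lemma galois_polyE n :
  galois_poly K n m = \sum_(w <- words m n) 'X^(inversions w).
Proof.
pose up (k : {ffun 'I_m -> 'I_n.+1}) : {ffun 'I_m -> nat} := [ffun i => k i : nat].
have up_inj : injective up.
  by move=> k l /ffunP e; apply/ffunP => i; have := e i; rewrite !ffunE => /val_inj.
transitivity (\sum_(k : {ffun 'I_m -> 'I_n.+1} | (\sum_(i < m) k i)%N == n)
    \sum_(w <- words m n | content w == up k) 'X^(inversions w) : {poly K}).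
  apply: eq_bigr => k /eqP kn.
  have upE i : up k i = k i by rewrite ffunE.
  have upn : (\sum_(i < m) up k i)%N = n by rewrite (eq_bigr _ (fun i _ => upE i)).
  have p0 : \prod_(i < m) qfact (k i) != 0 :> {poly K}.
    by apply/prodf_neq0 => i _; exact: qfact_neq0.
  apply: (mulIf p0); rewrite qmultinomialM // -(macmahon upn).
  by congr (_ * _); apply: eq_bigr => i _; rewrite upE.
under eq_bigr do rewrite big_mkcond.
rewrite exchange_big /=; apply: eq_big_seq => w /size_words wn.
have lt i : (content w i < n.+1)%N.
  by rewrite ltnS -wn -sum_content (bigD1 i) //= leq_addr.
pose k : {ffun 'I_m -> 'I_n.+1} := [ffun i => Ordinal (lt i)].
have kw : up k = content w by apply/ffunP => i; rewrite 2!ffunE.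
have kn : (\sum_(i < m) k i)%N == n.
  by rewrite -[X in _ == X]wn -sum_content; apply/eqP/eq_bigr => i _; rewrite ffunE.
rewrite (bigD1 k) //= -kw eqxx big1 ?addr0 // => l /andP[_ lk].
by rewrite (inj_eq up_inj) eq_sym (negPf lk).
Qed.

End MacMahon.

(** * Expectation over uniform random words *)

Section Average.
Context {R : realFieldType} {m : nat}.
Implicit Types (u : {ffun 'I_m -> nat}) (n : nat).

Definition average n (F : seq 'I_m -> R) : R :=
  m%:R ^- n * \sum_(w <- words m n) F w.

Lemma average0 F : average 0 F = F [::].
Proof. by rewrite /average sum_words0 expr0 invr1 mul1r. Qed.

Lemma averageS n F : average n.+1 F =
  m%:R^-1 * \sum_(a < m) average n (fun w => F (a :: w)).
Proof.
rewrite /average sum_words_cons -mulr_sumr exprSr invfM mulrA.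
by rewrite (mulrC _^-1).
Qed.

Lemma average_cat n1 n2 F : average (n1 + n2) F =
  average n1 (fun w1 => average n2 (fun w2 => F (w1 ++ w2))).
Proof.
by rewrite /average sum_words_cat -mulr_sumr exprD invfM mulrA.
Qed.

Lemma eq_average n F1 F2 : (forall w, size w = n -> F1 w = F2 w) ->
  average n F1 = average n F2.
Proof. by move=> e; congr (_ * _); apply: eq_big_seq => w /size_words /e. Qed.

Lemma ler_average n F1 F2 : (forall w, size w = n -> F1 w <= F2 w) ->
  average n F1 <= average n F2.
Proof.
move=> e; rewrite ler_wpM2l ?invr_ge0 ?exprn_ge0 ?ler0n //.
by rewrite !big_seq; apply: ler_sum => w /size_words /e.
Qed.

Lemma averageD n F1 F2 :
  average n (fun w => F1 w + F2 w) = average n F1 + average n F2.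
Proof. by rewrite /average big_split mulrDr. Qed.

Lemma averageZ n c F : average n (fun w => c * F w) = c * average n F.
Proof. by rewrite /average -mulr_sumr mulrCA. Qed.

Lemma averageZr n c F : average n (fun w => F w * c) = average n F * c.
Proof. by rewrite /average -mulr_suml mulrA. Qed.

Lemma averageB n F1 F2 :
  average n (fun w => F1 w - F2 w) = average n F1 - average n F2.
Proof. by rewrite /average sumrB mulrBr. Qed.

Lemma average_sum (I : Type) (r : seq I) n (F : I -> seq 'I_m -> R) :
  average n (fun w => \sum_(i <- r) F i w) = \sum_(i <- r) average n (F i).
Proof. by rewrite /average exchange_big /= -mulr_sumr. Qed.

Lemma ler_norm_average n F : `|average n F| <= average n (fun w => `|F w|).
Proof.
rewrite normrM ger0_norm ?invr_ge0 ?exprn_ge0 ?ler0n //.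
by rewrite ler_wpM2l ?invr_ge0 ?exprn_ge0 ?ler0n ?ler_norm_sum.
Qed.

Lemma average_exchange n1 n2 (F : seq 'I_m -> seq 'I_m -> R) :
  average n1 (fun w1 => average n2 (F w1)) =
  average n2 (fun w2 => average n1 (F ^~ w2)).
Proof.
by rewrite /average -!mulr_sumr exchange_big !mulrA (mulrC _^-1).
Qed.

Hypothesis m_gt0 : (0 < m)%N.

Lemma average_cst n c : average n (fun=> c) = c.
Proof.
elim: n => [|n IHn]; first exact: average0.
rewrite averageS (eq_bigr (fun=> c)) // sumr_const card_ord -[c *+ m]mulr_natl mulKf //.
by rewrite pnatr_eq0 -lt0n.
Qed.

End Average.

(** * MacMahon's formula on the unit circle, in real form *)

Section CosineMacMahon.
Context {R : realType} {m : nat}.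
Implicit Types (u : {ffun 'I_m -> nat}) (n : nat) (x theta : R).

(* The mean of the number of inversions given the content is
   [(n ^ 2 - \sum_i u i ^ 2) / 4]; the identity is the evaluation of MacMahon's
   formula at exp(2ix), in real form. *)
Lemma cosine_macmahon n u x theta : (\sum_(i < m) u i)%N = n ->
  (\sum_(w <- words m n | content w == u)
      cos (2 * x * (inversions w)%:R + theta))
    * \prod_(i < m) \prod_(j < u i) sin (j.+1%:R * x) =
  \prod_(j < n) sin (j.+1%:R * x)
    * cos (x * (n%:R ^+ 2 - \sum_(i < m) (u i)%:R ^+ 2) / 2 + theta).
Proof.
elim: n u theta => [|n IHn] u theta un.
  have u0 (i : 'I_m) : u i = 0%N.
    by apply/eqP; have /eqP := un; rewrite sum_nat_eq0 => /forallP /(_ i).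
  rewrite [X in _ * X]big1 => [|i _]; last by rewrite u0 big_ord0.
  rewrite big_mkcond sum_words0 /= big_ord0.
  rewrite (_ : content [::] == u); last by apply/eqP/ffunP => i; rewrite ffunE u0.
  rewrite big1 => [|i _]; last by rewrite u0 expr0n.
  by rewrite expr0n subrr !mulr0 mul0r add0r mul1r mulr1.
rewrite (sum_words_content_cons _ _ (fun k => cos (2 * x * k%:R + theta))) mulr_suml.
set q := \sum_(i < m) (u i)%:R ^+ 2.
(* [beta] is the phase expected on the right. As 2 sin(u_a x) cos A = sin(A + u_a x) - sin(A - u_a
   x), each first letter contributes a difference of values of [f]. *)
pose beta := x * (n.+1%:R ^+ 2 - q) / 2 + theta.
pose f (k : nat) := sin (beta + x * (2 * k%:R - n.+1%:R)).
transitivity (\sum_(a < m) 2^-1 * \prod_(j < n) sin (j.+1%:R * x) *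
    (f (below u a + u a)%N - f (below u a))); last first.
  rewrite -mulr_sumr sum_below_telescope un big_ord_recr /= /f.
  rewrite (_ : x * (2 * n.+1%:R - n.+1%:R) = n.+1%:R * x); last by ring.
  rewrite (_ : x * (2 * 0%:R - n.+1%:R) = - (n.+1%:R * x)); last by ring.
  by rewrite !sinD cosN sinN; field.
rewrite big_mkcond; apply: eq_bigr => a _; case: posnP => [-> | ua].
  by rewrite addn0 subrr mulr0.
(* The inversions of the first letter are absorbed in the phase, which is why [theta] is free in the
   induction. *)
under eq_bigr do rewrite natrD mulrDr -addrA addrCA.
rewrite (prod_remove (fun j => sin (j.+1%:R * x)) ua) prednK // mulrCA IHn; last first.
  by apply/eqP; rewrite -eqSS sum_remove ?un.
have -> : \sum_(i < m) (remove a u i)%:R ^+ 2 = q - 2 * (u a)%:R + 1 :> R.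
  rewrite /q (bigD1 a) //= [in RHS](bigD1 a) //= ffunE eqxx natrB //.
  have -> : \sum_(i < m | i != a) (remove a u i)%:R ^+ 2 =
      \sum_(i < m | i != a) (u i)%:R ^+ 2 :> R.
    by apply: eq_bigr => i /negPf ia; rewrite ffunE ia subn0.
  by rewrite -[true%:R]/1; ring.
set P := \prod_(j < n) _; set A := (X in cos X).
have eA : A = beta + x * (2 * (below u a)%:R + (u a)%:R - n.+1%:R).
  by rewrite /A /beta -natr1; field.
rewrite /f natrD.
have -> : beta + x * (2 * ((below u a)%:R + (u a)%:R) - n.+1%:R) = A + (u a)%:R * x.
  by rewrite eA; ring.
have -> : beta + x * (2 * (below u a)%:R - n.+1%:R) = A - (u a)%:R * x.
  by rewrite eA; ring.
by rewrite !sinD cosN sinN; field.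
Qed.

End CosineMacMahon.

(** * Calculus *)

Section Calculus.
Context {R : realType}.
Implicit Types (f g : R -> R) (a b x : R).

Lemma is_derive_fun_eq f x a b : is_derive x 1 f a -> a = b -> is_derive x 1 f b.
Proof. by move=> ? <-. Qed.

Lemma is_derive_fun_cst a x : is_derive x 1 (fun _ : R => a) 0.
Proof. exact: is_derive_cst. Qed.

Lemma is_derive_fun_id x : is_derive x 1 (fun t : R => t) 1.
Proof. exact: is_derive_id. Qed.

Lemma is_derive_funD f g x a b : is_derive x 1 f a -> is_derive x 1 g b ->
  is_derive x 1 (fun t => f t + g t) (a + b).
Proof. exact: is_deriveD. Qed.

Lemma is_derive_funN f x a : is_derive x 1 f a ->
  is_derive x 1 (fun t => - f t) (- a).
Proof. exact: is_deriveN. Qed.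

Lemma is_derive_funM f g x a b : is_derive x 1 f a -> is_derive x 1 g b ->
  is_derive x 1 (fun t => f t * g t) (f x * b + g x * a).
Proof. exact: is_deriveM. Qed.

Lemma is_derive_funX f n x a : is_derive x 1 f a ->
  is_derive x 1 (fun t => f t ^+ n) (n%:R * f x ^+ n.-1 * a).
Proof.
move=> fa; rewrite (_ : (fun t => f t ^+ n) = f ^+ n); first exact: is_deriveX.
by apply/funext => t; rewrite exprfctE.
Qed.

Lemma is_derive_fun_comp (h : R -> R) (dh : R) f x a :
  is_derive (f x) 1 h dh -> is_derive x 1 f a ->
  is_derive x 1 (fun t => h (f t)) (dh * a).
Proof. exact: is_derive1_comp. Qed.

End Calculus.

(** The constant rule comes first, so that subterms free of the variable are consumed whole. The
    derivative is built as an evar, and [derive] leaves its equality with the expected one. *)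
Ltac derive_step := first
  [ notypeclasses refine (is_derive_fun_cst _ _)
  | notypeclasses refine (is_derive_fun_id _)
  | notypeclasses refine (is_derive_funD _ _)
  | notypeclasses refine (is_derive_funN _)
  | notypeclasses refine (is_derive_funX _ _)
  | notypeclasses refine (is_derive_funM _ _)
  | notypeclasses refine (is_derive_fun_comp (is_derive_sin _) _)
  | notypeclasses refine (is_derive_fun_comp (is_derive_cos _) _)
  | notypeclasses refine (is_derive_fun_comp (is_derive_expR _) _) ].
Ltac derive := notypeclasses refine (is_derive_fun_eq _ _); [repeat derive_step|].

(** * Inequalities for the sine and its Gaussian correction *)

Section Sine.
Context {R : realType}.
Implicit Types (x y : R).

Lemma ler_is_derive (f df : R -> R) (a b : R) : a <= b ->
  (forall x, a <= x <= b -> is_derive x 1 f (df x)) ->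
  (forall x, a <= x <= b -> 0 <= df x) -> f a <= f b.
Proof.
move=> ab fdf df0; rewrite -subr_ge0.
have [||c cab ->] := @MVT_segment R f df a b ab.
    by move=> x; rewrite in_itv /= => /andP[ax xb]; apply: fdf; rewrite !ltW.
  apply: derivable_within_continuous => x; rewrite in_itv /= => xab.
  by have [] := fdf x xab.
by rewrite mulr_ge0 ?subr_ge0 // df0 // -in_itv.
Qed.

Lemma sin_le x : 0 <= x -> sin x <= x.
Proof.
move=> x0; have /= := @ler_is_derive (fun t => t - sin t) (fun t => 1 - cos t) 0 x x0.
rewrite sin0 subr0 subr_ge0; apply=> t _; last by rewrite subr_ge0 cos_le1.
Qed.

Lemma cos_ge x : 0 <= x -> 1 - x ^+ 2 / 2 <= cos x.
Proof.
move=> x0; rewrite -subr_ge0.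
have /= := @ler_is_derive (fun t => cos t - (1 - t ^+ 2 * 2^-1)) (fun t => t - sin t) 0 x x0.
rewrite cos0 expr0n mul0r subr0 subrr; apply=> t /andP[t0 _]; last by rewrite subr_ge0 sin_le.
by derive; rewrite /=; field.
Qed.

Lemma sin_ge x : 0 <= x -> x - x ^+ 3 / 6 <= sin x.
Proof.
move=> x0; rewrite -subr_ge0.
have /= := @ler_is_derive (fun t => sin t - (t - t ^+ 3 * 6^-1))
  (fun t => cos t - (1 - t ^+ 2 / 2)) 0 x x0.
rewrite sin0 expr0n mul0r !subr0; apply=> t /andP[t0 _]; last by rewrite subr_ge0 cos_ge.
by derive; rewrite /=; field.
Qed.

Lemma mul_cos_le_sin x : 0 <= x <= pi -> x * cos x <= sin x.
Proof.
move=> /andP[x0 xpi]; rewrite -subr_ge0.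
have /= := @ler_is_derive (fun t => sin t - t * cos t) (fun t => t * sin t) 0 x x0.
rewrite sin0 mul0r subr0; apply=> t /andP[t0 tx].
  by derive; rewrite /=; ring.
by rewrite mulr_ge0 // sin_ge0_pi // t0 (le_trans tx).
Qed.

(* The exponential cancels the first order of decay of [sin x / x], which makes
   quotients of sines comparable with quotients of Gaussians. *)
Definition gauss_sinc x : R := sin x / x * expR (x ^+ 2 / 6).

(** This expression over x^2, times the exponential, is the derivative of [- gauss_sinc]. Its cubic
    terms cancel: 1/6 is the largest coefficient for which monotonicity can hold. *)
Lemma gauss_sinc_numerator x : 0 <= x <= pi ->
  0 <= sin x - x * cos x - x ^+ 2 * sin x / 3.
Proof.
move=> /andP[x0 xpi].
have /= := @ler_is_derive (fun t => sin t - t * cos t - t ^+ 2 * sin t * 3^-1)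
  (fun t => t * 3^-1 * (sin t - t * cos t)) 0 x x0.
rewrite sin0 expr0n !mul0r !subr0; apply=> t /andP[t0 tx].
  by derive; rewrite /=; field.
by rewrite !mulr_ge0 ?invr_ge0 ?ler0n // subr_ge0 mul_cos_le_sin // t0 (le_trans tx).
Qed.

Lemma gauss_sinc_nincr x y : 0 < x -> x <= y <= pi -> gauss_sinc y <= gauss_sinc x.
Proof.
move=> x0 /andP[xy ypi]; rewrite -lerN2.
apply: (@ler_is_derive (fun t => - gauss_sinc t) (fun t =>
  (sin t - t * cos t - t ^+ 2 * sin t / 3) / t ^+ 2 * expR (t ^+ 2 / 6)) x y xy).
  move=> t /andP[xt ty]; have t0 : t != 0 by rewrite gt_eqF // (lt_le_trans x0).
  rewrite /gauss_sinc; derive; first exact: is_deriveV.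
  by rewrite /GRing.scale /=; field.
move=> t /andP[xt ty].
rewrite mulr_ge0 ?expR_ge0 // mulr_ge0 ?invr_ge0 ?sqr_ge0 // gauss_sinc_numerator //.
by rewrite (le_trans (ltW x0) xt) (le_trans ty).
Qed.

Lemma gauss_sinc_gt0 x : 0 < x < pi -> 0 < gauss_sinc x.
Proof.
move=> /andP[x0 xpi].
by rewrite /gauss_sinc !mulr_gt0 ?expR_gt0 ?invr_gt0 ?sin_gt0_pi ?x0.
Qed.

Lemma gauss_sinc_ge0 x : 0 < x <= pi -> 0 <= gauss_sinc x.
Proof.
move=> /andP[x0 xpi].
by rewrite /gauss_sinc !mulr_ge0 ?expR_ge0 ?invr_ge0 ?sin_ge0_pi ?xpi ?(ltW x0).
Qed.

Lemma gauss_sinc_le1 x : 0 < x <= pi -> gauss_sinc x <= 1.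
Proof.
move=> /andP[x0 xpi]; apply/ler_addgt0Pr => e e0.
(* The value 1 is only a limit at 0, where the quotient is 0 by convention. A small [y] replaces it:
   [gauss_sinc y] is at most exp(y^2/6), and y^2 <= min(1, e) brings this below 1 + e. *)
pose y := Num.min x (Num.min 1 e).
have y0 : 0 < y by rewrite !lt_min x0 e0 ltr01.
have yx : y <= x by rewrite ge_min lexx.
have y1 : y <= 1 by rewrite !ge_min lexx !orbT.
have ye : y <= e by rewrite !ge_min lexx !orbT.
apply: le_trans (_ : gauss_sinc y <= _); first by rewrite gauss_sinc_nincr // yx.
apply: le_trans (_ : expR (y ^+ 2 / 6) <= _).
  by rewrite ler_piMl ?expR_ge0 // ler_pdivrMr // mul1r sin_le ?ltW.
rewrite -[y ^+ 2 / 6]opprK expRN invf_ple ?posrE ?expR_gt0 ?addr_gt0 //.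
apply: le_trans (expR_ge1Dx _).
rewrite -[_^-1]mul1r ler_pdivrMr ?addr_gt0 //.
have y21 : y ^+ 2 <= 1 by rewrite expr_le1 // ltW.
have y2e : y ^+ 2 <= e by rewrite (le_trans _ ye) // expr2 ler_piMl // ltW.
nra.
Qed.

(** The left side is (1 - x^2/6)(1 + x^2/6), whose factors bound sin x / x and the exponential from
    below. For x^2 >= 6 it is not positive. *)
Lemma gauss_sinc_ge x : 0 < x <= pi -> 1 - x ^+ 4 / 36 <= gauss_sinc x.
Proof.
move=> xpi; have /andP[x0 _] := xpi.
have [x6|x6] := leP (6 : R) (x ^+ 2).
  apply: le_trans (gauss_sinc_ge0 xpi).
  by rewrite (_ : x ^+ 4 = x ^+ 2 * x ^+ 2); [nra | rewrite -exprD].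
rewrite (_ : 1 - _ = (1 - x ^+ 2 / 6) * (1 + x ^+ 2 / 6)); last by field.
apply: ler_pM; [lra | nra | | exact: expR_ge1Dx].
rewrite ler_pdivlMr // (le_trans _ (sin_ge (ltW x0))) //.
by rewrite le_eqVlt; apply/orP; left; apply/eqP; field.
Qed.

End Sine.

(** * Conditioning on the content *)

Section ContentAverage.
Context {R : realFieldType} {m : nat}.
Implicit Types (u : {ffun 'I_m -> nat}) (w : seq 'I_m) (n : nat).

Definition multiplicity n u : R := \sum_(w <- words m n | content w == u) 1.

(** MacMahon's formula at q = 1. *)
Lemma multiplicityM n u : (\sum_(i < m) u i)%N = n ->
  multiplicity n u * \prod_(i < m) (u i)`!%:R = n`!%:R.
Proof.
have qfact1 k : (qfact k).[1] = k`!%:R :> R.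
  rewrite qfactE horner_prod fact_prod natr_prod big_add1 /= big_mkord.
  apply: eq_bigr => j _; rewrite qintE horner_sum.
  under eq_bigr do rewrite hornerXn expr1n.
  by rewrite sumr_const card_ord.
move/(macmahon (K := R)) => /(congr1 (fun p => p.[1])).
rewrite hornerM horner_prod horner_sum qfact1 => <-; congr (_ * _).
  by apply: eq_bigr => w _; rewrite hornerXn expr1n.
by apply: eq_bigr => i _; rewrite qfact1.
Qed.

Lemma multiplicity_neq0 n u : (\sum_(i < m) u i)%N = n -> multiplicity n u != 0.
Proof.
move=> /multiplicityM e; have : n`!%:R != 0 :> R by rewrite pnatr_eq0 -lt0n fact_gt0.
by apply: contraNneq => m0; rewrite -e m0 mul0r.
Qed.

(** Conditioning on the content: [G u] is the mean of [F u] over the words of content [u]. Each word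
    is spread evenly over its content class, then the two sums are exchanged. *)
Lemma average_content n (F : {ffun 'I_m -> nat} -> seq 'I_m -> R) G :
  (forall u, (\sum_(i < m) u i)%N = n ->
     \sum_(w <- words m n | content w == u) F u w = multiplicity n u * G u) ->
  average n (fun w => F (content w) w) = average n (fun w => G (content w)).
Proof.
move=> FG; congr (_ * _).
have cn w : w \in words m n -> (\sum_(i < m) content w i)%N = n.
  by move=> /size_words; rewrite sum_content.
transitivity (\sum_(w <- words m n) \sum_(w' <- words m n | content w' == content w)
    (multiplicity n (content w'))^-1 * F (content w') w).
  apply: eq_big_seq => w ww.
  rewrite (eq_bigr (fun w' => (multiplicity n (content w))^-1 * F (content w) w * 1)).
    by rewrite -mulr_sumr mulrC mulVKf // multiplicity_neq0 // cn.
  by move=> w' /eqP ->; rewrite mulr1.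
under eq_bigr do rewrite big_mkcond.
rewrite exchange_big; apply: eq_big_seq => w ww /=.
rewrite -big_mkcond -mulr_sumr.
under eq_bigl do rewrite eq_sym.
by rewrite FG ?mulKf ?multiplicity_neq0 // cn.
Qed.

End ContentAverage.

Section ConditionalCosine.
Context {R : realType} {m : nat}.
Implicit Types (u : {ffun 'I_m -> nat}) (w : seq 'I_m) (n : nat) (x theta : R).

Definition gauss_sinc_prod x n : R := \prod_(j < n) gauss_sinc (j.+1%:R * x).

Definition sum_squares u : R := \sum_(i < m) (u i)%:R ^+ 2.

Definition pyramid (k : nat) : R := \sum_(j < k) j.+1%:R ^+ 2.

(** This is D(u); a twelfth of it is the variance of the number of inversions of a uniform word of
    length n and content [u]. *)
Definition pyramid_defect n u : R := pyramid n - \sum_(i < m) pyramid (u i).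

Definition gauss_sinc_ratio x n u : R :=
  gauss_sinc_prod x n / \prod_(i < m) gauss_sinc_prod x (u i).

(* The characteristic function at 2x, given the content u, is this factor times
   the phase exp(ix(n ^ 2 - sum_squares u) / 2). *)
Definition conditional_factor x n u : R :=
  gauss_sinc_ratio x n u * expR (- (x ^+ 2 / 6 * pyramid_defect n u)).

Lemma prod_sinE x k : x != 0 -> \prod_(j < k) sin (j.+1%:R * x) =
  k`!%:R * x ^+ k * gauss_sinc_prod x k * expR (- (x ^+ 2 / 6 * pyramid k)).
Proof.
move=> x0; elim: k => [|k IHk].
  by rewrite /gauss_sinc_prod /pyramid !big_ord0 mulr0 oppr0 expR0 !mulr1.
rewrite /gauss_sinc_prod /pyramid !big_ord_recr /= -/(gauss_sinc_prod x k).
rewrite -/(pyramid k) IHk factS natrM (exprSr x k) /gauss_sinc.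
set s := sin _.
have -> : - (x ^+ 2 / 6 * (pyramid k + k.+1%:R ^+ 2)) =
  - (x ^+ 2 / 6 * pyramid k) - (k.+1%:R * x) ^+ 2 / 6 by ring.
rewrite expRD [expR (- (_ ^+ 2 / 6))]expRN.
have e0 : expR ((k.+1%:R * x) ^+ 2 / 6) != 0 by rewrite gt_eqF ?expR_gt0.
have k0 : k.+1%:R != 0 :> R by rewrite pnatr_eq0.
move: (expR _) (expR _) e0 => e1 e2 e0; move: (gauss_sinc_prod x k) => G.
by field; rewrite x0 e0 nat1r k0.
Qed.

Lemma gauss_sinc_prod_gt0 x k : 0 < x -> k%:R * x < pi -> 0 < gauss_sinc_prod x k.
Proof.
move=> x0 kx; apply: prodr_gt0 => j _; rewrite gauss_sinc_gt0 // mulr_gt0 ?ltr0n //=.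
by rewrite (le_lt_trans _ kx) // ler_pM2r // ler_nat.
Qed.

Lemma content_le n u i : (\sum_(i < m) u i)%N = n -> (u i <= n)%N.
Proof. by move=> <-; rewrite (bigD1 i) //= leq_addr. Qed.

Lemma content_arg_lt x n u i : 0 < x -> n%:R * x < pi ->
  (\sum_(i < m) u i)%N = n -> (u i)%:R * x < pi.
Proof.
by move=> x0 nx un; rewrite (le_lt_trans _ nx) // ler_pM2r // ler_nat (content_le _ un).
Qed.

(** Each sin(jx) is j x g(jx) exp(-(jx)^2/6). The factorials make up the multiplicity, the powers of
    x cancel because the u_i add up to n, and the exponentials combine into D(u). The bound on n x
    keeps the divisors nonzero. *)
Lemma conditional_cosine n u x theta : 0 < x -> n%:R * x < pi ->
  (\sum_(i < m) u i)%N = n ->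
  \sum_(w <- words m n | content w == u) cos (2 * x * (inversions w)%:R + theta) =
  multiplicity n u * (conditional_factor x n u *
    cos (x * (n%:R ^+ 2 - sum_squares u) / 2 + theta)).
Proof.
move=> x0 nx un; have x0' : x != 0 by rewrite gt_eqF.
have := cosine_macmahon x theta un.
rewrite prod_sinE //.
under [X in _ * X]eq_bigr do rewrite prod_sinE //.
rewrite !big_split /= -(multiplicityM (R := R) un).
rewrite prodrXr un -expR_sum sumrN -mulr_sumr -/(sum_squares u).
have -> : - (x ^+ 2 / 6 * \sum_(i < m) pyramid (u i)) =
  - (x ^+ 2 / 6 * pyramid n) - - (x ^+ 2 / 6 * pyramid_defect n u).
  by rewrite /pyramid_defect; ring.
rewrite expRB => e; rewrite /conditional_factor /gauss_sinc_ratio.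
set C := cos _ in e *; set S := \sum_(w <- _ | _) _ in e *.
move: e; set F := \prod_(i < m) _; set Q := \prod_(i < m) _ => e.
have F0 : F != 0 by rewrite /F prodf_seq_neq0; apply/allP => i _; rewrite pnatr_eq0 -lt0n fact_gt0.
have Q0 : Q != 0.
  rewrite /Q prodf_seq_neq0; apply/allP => i _.
  by rewrite gt_eqF // gauss_sinc_prod_gt0 // (content_arg_lt i x0 nx un).
have e1 : expR (- (x ^+ 2 / 6 * pyramid n)) != 0 by rewrite gt_eqF ?expR_gt0.
have e2 : expR (- (x ^+ 2 / 6 * pyramid_defect n u)) != 0 by rewrite gt_eqF ?expR_gt0.
have xn : x ^+ n != 0 by rewrite expf_neq0.
move: (expR _) (expR _) (x ^+ n) (gauss_sinc_prod x n) e1 e2 xn e => a b xx g a0 b0 xx0 e.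
have : F * xx * Q * a != 0 by rewrite !mulf_neq0.
move/mulIf; apply.
transitivity ((S * (F * xx * Q * (b / a))) * (a * a / b)); first by field; rewrite a0.
by rewrite e; field; rewrite ?Q0 ?a0 ?b0.
Qed.

Lemma conditional_average n x (theta : {ffun 'I_m -> nat} -> R) :
  0 < x -> n%:R * x < pi ->
  average n (fun w => cos (2 * x * (inversions w)%:R + theta (content w))) =
  average n (fun w => conditional_factor x n (content w) *
    cos (x * (n%:R ^+ 2 - sum_squares (content w)) / 2 + theta (content w))).
Proof.
move=> x0 nx.
rewrite (average_content (F := fun u w => cos (2 * x * (inversions w)%:R + theta u))
  (G := fun u => conditional_factor x n u *
    cos (x * (n%:R ^+ 2 - sum_squares u) / 2 + theta u))) // => u un.
exact: conditional_cosine.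
Qed.

End ConditionalCosine.

(** * Bounds on the conditional factor *)

Section ConditionalBounds.
Context {R : realType} {m : nat}.
Implicit Types (u : {ffun 'I_m -> nat}) (w : seq 'I_m) (n : nat) (x theta : R).

(** The factor of rank a + j is at most the one of rank j, as [gauss_sinc] is nonincreasing. *)
Lemma gauss_sinc_prod_submul x a b : 0 < x -> (a + b)%:R * x < pi ->
  gauss_sinc_prod x (a + b) <= gauss_sinc_prod x a * gauss_sinc_prod x b.
Proof.
move=> x0 abx.
rewrite /gauss_sinc_prod big_split_ord /= ler_pM2l; last first.
  by apply: gauss_sinc_prod_gt0 => //; rewrite (le_lt_trans _ abx) // ler_pM2r // ler_nat leq_addr.
have jx (j : 'I_b) : (a + j).+1%:R * x < pi.
  by rewrite (le_lt_trans _ abx) // ler_pM2r // ler_nat -addnS leq_add2l.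
apply: ler_prod => j _; apply/andP; split.
  by rewrite gauss_sinc_ge0 ?mulr_gt0 ?ltr0n ?(ltW (jx j)).
apply: gauss_sinc_nincr; first by rewrite mulr_gt0 ?ltr0n.
by rewrite ler_pM2r // ler_nat ltnS leq_addl ltW.
Qed.

Lemma gauss_sinc_prod_le1 x k : 0 < x -> k%:R * x < pi -> gauss_sinc_prod x k <= 1.
Proof.
move=> x0 kx; apply: prodr_ile1 => j _.
have jx : j.+1%:R * x <= pi.
  by rewrite ltW // (le_lt_trans _ kx) // ler_pM2r // ler_nat.
by rewrite gauss_sinc_ge0 ?gauss_sinc_le1 // mulr_gt0 ?ltr0n ?jx.
Qed.

(** Bernoulli's inequality for k factors between 1 - e and 1, with e = (n x)^4 / 36. *)
Lemma gauss_sinc_prod_ge x n k : 0 < x -> n%:R * x < pi -> (k <= n)%N ->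
  1 - k%:R * ((n%:R * x) ^+ 4 / 36) <= gauss_sinc_prod x k.
Proof.
move=> x0 nx; elim: k => [|k IHk] kn; first by rewrite /gauss_sinc_prod big_ord0 mul0r subr0.
have ltk j : (j <= n)%N -> j%:R * x < pi.
  by move=> jn; rewrite (le_lt_trans _ nx) // ler_pM2r // ler_nat.
rewrite /gauss_sinc_prod big_ord_recr /= -/(gauss_sinc_prod x k).
set P := gauss_sinc_prod x k; set G := gauss_sinc _.
have P1 : P <= 1 by apply: gauss_sinc_prod_le1 => //; apply/ltk/ltnW.
have P0 : 0 < P by apply: gauss_sinc_prod_gt0 => //; apply/ltk/ltnW.
have kx : 0 < k.+1%:R * x <= pi by rewrite mulr_gt0 ?ltr0n //= ltW ?ltk.
have G1 : G <= 1 by apply: gauss_sinc_le1.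
have Gn : 1 - (n%:R * x) ^+ 4 / 36 <= G.
  apply: le_trans (gauss_sinc_ge kx); rewrite lerB // ler_pM2r ?invr_gt0 ?ltr0n //.
  by rewrite lerXn2r ?nnegrE ?mulr_ge0 ?ler0n ?(ltW x0) // ler_pM2r ?ler_nat.
have := IHk (ltnW kn); rewrite -/P -[k.+1%:R]natr1 mulrDl mul1r; move: Gn.
set e := _ / 36; set f := _ * e; nra.
Qed.

Lemma gauss_sinc_ratio_le1 x n u : 0 < x -> n%:R * x < pi ->
  (\sum_(i < m) u i)%N = n -> gauss_sinc_ratio x n u <= 1.
Proof.
move=> x0 nx un.
have P0 : 0 < \prod_(i < m) gauss_sinc_prod x (u i).
  by apply: prodr_gt0 => i _; rewrite gauss_sinc_prod_gt0 // (content_arg_lt i x0 nx un).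
rewrite ler_pdivrMr // mul1r -un.
suff : (\sum_(i < m) u i)%:R * x < pi ->
    0 <= gauss_sinc_prod x (\sum_(i < m) u i) <= \prod_(i < m) gauss_sinc_prod x (u i).
  by rewrite un => /(_ nx) /andP[].
elim/big_rec2: _ => [|i p k _ IH] kx.
  by rewrite /gauss_sinc_prod big_ord0 ler01 lexx.
rewrite ltW ?gauss_sinc_prod_gt0 //=.
have ux : (u i)%:R * x < pi by rewrite (le_lt_trans _ kx) // ler_pM2r // ler_nat leq_addr.
have /IH /andP[p0 p1] : k%:R * x < pi.
  by rewrite (le_lt_trans _ kx) // ler_pM2r // ler_nat leq_addl.
apply: le_trans (gauss_sinc_prod_submul x0 kx) _.
by rewrite ler_pM2l // gauss_sinc_prod_gt0.
Qed.

Lemma gauss_sinc_ratio_gt0 x n u : 0 < x -> n%:R * x < pi ->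
  (\sum_(i < m) u i)%N = n -> 0 < gauss_sinc_ratio x n u.
Proof.
move=> x0 nx un; rewrite divr_gt0 ?gauss_sinc_prod_gt0 //.
by apply: prodr_gt0 => i _; rewrite gauss_sinc_prod_gt0 // (content_arg_lt i x0 nx un).
Qed.

(** The denominator is at most 1, so the numerator alone is a lower bound, independent of the number
    of letters. *)
Lemma gauss_sinc_ratio_ge x n u : 0 < x -> n%:R * x < pi ->
  (\sum_(i < m) u i)%N = n -> 1 - n%:R ^+ 5 * x ^+ 4 / 36 <= gauss_sinc_ratio x n u.
Proof.
move=> x0 nx un.
have P0 : 0 < \prod_(i < m) gauss_sinc_prod x (u i).
  by apply: prodr_gt0 => i _; rewrite gauss_sinc_prod_gt0 // (content_arg_lt i x0 nx un).
apply: le_trans (_ : gauss_sinc_prod x n <= _).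
  by apply: le_trans (gauss_sinc_prod_ge x0 nx (leqnn n)); rewrite exprMn exprS !mulrA.
rewrite ler_pdivlMr // ler_piMr ?(ltW (gauss_sinc_prod_gt0 x0 nx)) //.
apply: prodr_ile1 => i _; have ux := content_arg_lt i x0 nx un.
by rewrite ltW ?gauss_sinc_prod_gt0 ?gauss_sinc_prod_le1.
Qed.

Lemma pyramidE k : pyramid k = k%:R ^+ 3 / 3 + k%:R ^+ 2 / 2 + k%:R / 6 :> R.
Proof.
elim: k => [|k IHk]; first by rewrite /pyramid big_ord0 !expr0n !mul0r !addr0.
by rewrite /pyramid big_ord_recr /= -/(pyramid k) IHk -natr1; field.
Qed.

Lemma sum_contentR n u : (\sum_(i < m) u i)%N = n -> \sum_(i < m) (u i)%:R = n%:R :> R.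
Proof. by move=> <-; rewrite natr_sum. Qed.

Lemma pyramid_defectE n u : (\sum_(i < m) u i)%N = n -> pyramid_defect n u =
  (n%:R ^+ 3 - \sum_(i < m) (u i)%:R ^+ 3) / 3
  + (n%:R ^+ 2 - sum_squares u) / 2 :> R.
Proof.
move=> un; rewrite /pyramid_defect pyramidE.
under eq_bigr do rewrite pyramidE.
by rewrite !big_split /= -!mulr_suml (sum_contentR un) /sum_squares; field.
Qed.

Lemma sum_squares_le n u : (\sum_(i < m) u i)%N = n -> sum_squares u <= n%:R ^+ 2 :> R.
Proof.
move=> un; rewrite expr2 -{2}(sum_contentR un) mulr_sumr; apply: ler_sum => i _.
by rewrite expr2 ler_wpM2r ?ler0n // ler_nat (content_le _ un).
Qed.

Lemma pyramid_defect_ge n u : (\sum_(i < m) u i)%N = n ->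
  n%:R * (n%:R ^+ 2 - sum_squares u) / 3 <= pyramid_defect n u :> R.
Proof.
move=> un; rewrite (pyramid_defectE un).
have : \sum_(i < m) (u i)%:R ^+ 3 <= n%:R * sum_squares u :> R.
  rewrite mulr_sumr; apply: ler_sum => i _.
  by rewrite exprS ler_wpM2r ?sqr_ge0 // ler_nat (content_le _ un).
by have := sum_squares_le un; lra.
Qed.

Lemma conditional_factor_norm x n u : 0 < x -> n%:R * x < pi ->
  (\sum_(i < m) u i)%N = n ->
  `|conditional_factor x n u| <= expR (- (x ^+ 2 * n%:R / 18 * (n%:R ^+ 2 - sum_squares u))).
Proof.
move=> x0 nx un; rewrite normrM !ger0_norm ?expR_ge0 ?(ltW (gauss_sinc_ratio_gt0 x0 nx un)) //.
apply: le_trans (_ : expR (- (x ^+ 2 / 6 * pyramid_defect n u)) <= _).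
  by rewrite ler_piMl ?expR_ge0 ?gauss_sinc_ratio_le1.
rewrite ler_expR lerN2.
have := pyramid_defect_ge un; have : 0 <= x ^+ 2 by exact: sqr_ge0.
set q := n%:R ^+ 2 - _; rewrite -[n%:R * q / 3]mulrA => x2 h.
rewrite (_ : _ * q = x ^+ 2 / 6 * (n%:R * (q / 3))); last by field.
by rewrite ler_wpM2l // divr_ge0.
Qed.

(* The pairs are disjoint, so that for a random word their contributions are
   independent. *)
Fixpoint unequal_pairs w : nat :=
  if w is a :: w1 then if w1 is b :: w' then ((a != b) + unequal_pairs w')%N else 0%N
  else 0%N.

(** Each pair contributes at most 2 to the left side: an unequal pair contains [i] at most once. *)
Lemma unequal_pairs_count w i : (unequal_pairs w + count_mem i w <= size w)%N.
Proof.
have [k] := ubnP (size w); elim: k w => // k IHk [|a [|b w]] //= sw.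
  by case: (a == i).
have /IHk : (size w < k)%N by exact: ltnW.
case: (a =P b) => [->|ab]; case: (b =P i) => [bi|_]; case: (a =P i) => [ai|_] /=; try lia.
by case: ab; rewrite ai bi.
Qed.

(** With n the size, the right side is the sum of u_i (n - u_i), and each n - u_i is at least the
    number of unequal pairs. *)
Lemma unequal_pairs_le w :
  (size w)%:R * (unequal_pairs w)%:R <= (size w)%:R ^+ 2 - sum_squares (content w) :> R.
Proof.
have sw := sum_contentR (sum_content w).
rewrite expr2 -{1 2}sw !mulr_suml -sumrB; apply: ler_sum => i _.
rewrite expr2 -mulrBr ler_wpM2l ?ler0n // lerBrDr -natrD ler_nat ffunE.
exact: unequal_pairs_count.
Qed.

Hypothesis m_ge2 : (2 <= m)%N.

(** The pairs are independent, and each is unequal with probability 1 - 1/m >= 1/2; the bound for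
    one pair is attained at m = 2. *)
Lemma average_expR_pairs n (y : R) : 0 <= y ->
  average n (fun w => expR (- (y * (unequal_pairs w)%:R))) <=
  ((1 + expR (- y)) / 2) ^+ n./2.
Proof.
move=> y0; set r := (1 + expR (- y)) / 2.
have r0 : 0 <= r by rewrite divr_ge0 // addr_ge0 ?expR_ge0.
have m0 : (m%:R : R) != 0 by rewrite pnatr_eq0 -lt0n ltnW.
(* Letters are removed two at a time, hence a simultaneous induction on consecutive lengths. *)
suff [] : average n (fun w => expR (- (y * (unequal_pairs w)%:R))) <= r ^+ n./2 /\
  average n.+1 (fun w => expR (- (y * (unequal_pairs w)%:R))) <= r ^+ n.+1./2 by [].
elim: n => [|n [IHn IHn1]].
  rewrite averageS average0 /= mulr0 oppr0 expR0.
  rewrite (eq_bigr (fun=> 1)); last by move=> a _; rewrite average0 /= mulr0 oppr0 expR0.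
  by rewrite sumr_const card_ord mulVf.
split; first exact: IHn1.
set A := average n _ in IHn.
have -> : average n.+2 (fun w => expR (- (y * (unequal_pairs w)%:R))) =
    m%:R^-1 * (1 + (m%:R - 1) * expR (- y)) * A.
  rewrite averageS (eq_bigr (fun=> m%:R^-1 * ((1 + (m%:R - 1) * expR (- y)) * A))); last first.
    move=> a _; rewrite averageS; congr (_ * _).
    rewrite (eq_bigr (fun b => expR (- (y * (a != b)%:R)) * A)); last first.
      move=> b _; rewrite -averageZ; apply: eq_average => w _ /=.
      by rewrite natrD mulrDr opprD expRD.
    rewrite -mulr_suml (bigD1 a) //= eqxx mulr0 oppr0 expR0; congr ((_ + _) * _).
    rewrite (eq_bigr (fun=> expR (- y))); last first.
      by move=> b; rewrite eq_sym => ->; rewrite mulr1.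
    rewrite sumr_const cardC1 card_ord -[_ *+ _]mulr_natl; congr (_ * _).
    by rewrite -subn1 natrB // ltnW.
  by rewrite sumr_const card_ord -[_ *+ m]mulr_natl; field.
rewrite /= exprS; apply: ler_pM => //.
    by rewrite mulr_ge0 ?invr_ge0 // addr_ge0 // mulr_ge0 ?expR_ge0 // subr_ge0 ler1n ltnW.
  by rewrite mulr_ge0 ?invr_ge0 ?exprn_ge0 //; apply: sumr_ge0 => w _; exact: expR_ge0.
rewrite ler_pdivrMl ?ltr0n 1?ltnW // /r.
have e1 : expR (- y) <= 1 by rewrite expR_le1 oppr_le0.
have : (2 : R) <= m%:R by rewrite ler_nat.
by move: (expR _) e1 => e e1 m2; rewrite mulrA ler_pdivlMr //; nra.
Qed.

End ConditionalBounds.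

(** * Decay of the characteristic function *)

Section CharacteristicBounds.
Context {R : realType} {m : nat}.
Implicit Types (u : {ffun 'I_m -> nat}) (w : seq 'I_m) (n : nat) (x y theta : R).
Hypothesis m_ge2 : (2 <= m)%N.

(* The phase depending on the content makes the bound pass to concatenations:
   the inversions between two blocks depend on their contents only. *)
Definition cosine_bound n x (beta : R) : Prop :=
  forall theta : {ffun 'I_m -> nat} -> R,
  `|average n (fun w => cos (2 * x * (inversions w)%:R + theta (content w)))| <= beta.

Definition pair_rate y : R := (1 + expR (- y)) / 2.

Lemma pair_rate_ge0 y : 0 <= pair_rate y.
Proof. by rewrite divr_ge0 // addr_ge0 ?expR_ge0. Qed.

Lemma pair_rate_le1 y : 0 <= y -> pair_rate y <= 1.
Proof.
move=> y0; rewrite ler_pdivrMr // mul1r -lerBrDl -[X in _ <= X]/(1 + 1 - 1 : R).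
by rewrite addrK expR_le1 oppr_le0.
Qed.

Lemma pair_rate_nincr y1 y2 : y1 <= y2 -> pair_rate y2 <= pair_rate y1.
Proof. by move=> y12; rewrite ler_pM2r ?invr_gt0 // lerD2l ler_expR lerN2. Qed.

Lemma cosine_bound1 n x : cosine_bound n x 1.
Proof.
move=> theta; apply: le_trans (ler_norm_average _ _) _.
rewrite -[X in _ <= X](average_cst (ltnW m_ge2) n).
by apply: ler_average => w _; exact: cos_max.
Qed.

Lemma average_conditional_factor n x : 0 < x -> n%:R * x < pi ->
  average n (fun w => `|conditional_factor x n (content w)|) <=
  pair_rate ((n%:R * x) ^+ 2 / 18) ^+ n./2.
Proof.
move=> x0 nx.
apply: le_trans (average_expR_pairs m_ge2 n _); last by rewrite divr_ge0 ?sqr_ge0.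
apply: ler_average => w wn.
apply: le_trans (conditional_factor_norm x0 nx _) _; first by rewrite sum_content.
rewrite ler_expR lerN2; have := unequal_pairs_le (R := R) w; rewrite wn => h.
apply: le_trans (_ : x ^+ 2 * n%:R / 18 * (n%:R * (unequal_pairs w)%:R) <= _).
  by rewrite le_eqVlt; apply/orP; left; apply/eqP; field.
by rewrite ler_wpM2l // divr_ge0 // mulr_ge0 ?sqr_ge0.
Qed.

(** With the second block fixed, its inversions and the cross inversions form a phase in the content
    of the first block, to which the conditional formula applies. With the first block then fixed,
    what remains is again a content-dependent phase for the second one. *)
Lemma cosine_boundD a b x beta : 0 < x -> a%:R * x < pi -> cosine_bound b x beta ->
  cosine_bound (a + b) x (pair_rate ((a%:R * x) ^+ 2 / 18) ^+ a./2 * beta).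
Proof.
move=> x0 ax hb theta.
pose cross (u v : {ffun 'I_m -> nat}) : R := 2 * x * (\sum_(i < m) u i * below v i)%:R.
pose join (u v : {ffun 'I_m -> nat}) : {ffun 'I_m -> nat} := [ffun i => (u i + v i)%N].
have -> : average (a + b)
      (fun w => cos (2 * x * (inversions w)%:R + theta (content w))) =
    average a (fun w1 => conditional_factor x a (content w1) *
      average b (fun w2 => cos (2 * x * (inversions w2)%:R +
        (x * (a%:R ^+ 2 - sum_squares (content w1)) / 2
         + cross (content w1) (content w2) + theta (join (content w1) (content w2)))))).
  rewrite average_cat average_exchange.
  under [RHS]eq_average do rewrite -averageZ.
  rewrite [RHS]average_exchange; apply: eq_average => w2 _.
  pose theta2 u := 2 * x * (inversions w2)%:R + cross u (content w2)
    + theta (join u (content w2)).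
  transitivity (average a (fun w => cos (2 * x * (inversions w)%:R + theta2 (content w)))).
    apply: eq_average => w _; rewrite inversions_cat content_cat /theta2 /cross.
    by rewrite !natrD; congr (cos _); rewrite !mulrDr !addrA.
  rewrite conditional_average //; apply: eq_average => w _; congr (_ * cos _).
  by rewrite /theta2 /=; ring.
apply: le_trans (ler_norm_average _ _) _.
have beta0 : 0 <= beta by apply: le_trans (normr_ge0 _) (hb (fun=> 0)).
apply: le_trans (_ : average a (fun w => `|conditional_factor x a (content w)| * beta) <= _).
  apply: ler_average => w1 _; rewrite normrM ler_wpM2l //.
  exact: (hb (fun v => x * (a%:R ^+ 2 - sum_squares (content w1)) / 2
         + cross (content w1) v + theta (join (content w1) v))).
by rewrite averageZr ler_wpM2r // average_conditional_factor.
Qed.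

Lemma cosine_bound_block n x : 0 < x -> n%:R * x < pi ->
  cosine_bound n x (pair_rate ((n%:R * x) ^+ 2 / 18) ^+ n./2).
Proof.
by move=> x0 nx; have := cosine_boundD x0 nx (cosine_bound1 0 x); rewrite addn0 mulr1.
Qed.

Lemma cosine_bound_blocks L J r x : 0 < x -> L%:R * x < pi ->
  cosine_bound (J * L + r) x (pair_rate ((L%:R * x) ^+ 2 / 18) ^+ (J * L./2)).
Proof.
move=> x0 Lx; elim: J => [|J IHJ]; first by rewrite mul0n expr0; exact: cosine_bound1.
by rewrite mulSn -addnA mulSn exprD; exact: cosine_boundD.
Qed.

(** Blocks of length L >= 2 with 1/2 <= L x < pi have rate at argument (1/2)^2 / 18 = 1/72 or
    better. In n %/ 6, a factor 3 comes from [L./2] being at least L/3, and a factor 2 from the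
    incomplete last block. *)
Lemma cosine_bound_far n x : (2 <= n)%N -> 0 < x -> x < pi / 2 -> 1 / 2 <= n%:R * x ->
  cosine_bound n x (pair_rate (1 / 72) ^+ (n %/ 6)).
Proof.
move=> n2 x0 xpi nx.
suff [e [ne he]] : exists e, (n <= 6 * e)%N /\ cosine_bound n x (pair_rate (1 / 72) ^+ e).
  move=> theta; apply: le_trans (he theta) _.
  rewrite ler_wiXn2l ?pair_rate_ge0 ?pair_rate_le1 //; lia.
have weaken k J : 1 / 2 <= k%:R * x ->
    pair_rate ((k%:R * x) ^+ 2 / 18) ^+ J <= pair_rate (1 / 72) ^+ J.
  move=> kx; rewrite lerXn2r ?nnegrE ?pair_rate_ge0 // pair_rate_nincr //; nra.
have [npi|pin] := ltP (n%:R * x) pi.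
  exists n./2; split; first by lia.
  by move=> theta; apply: le_trans (cosine_bound_block x0 npi theta) (weaken _ _ nx).
(* The block length is [k.-1], the largest L with L x < pi. As x < pi/2, it is at least 2 and L x >=
   pi - x > 1/2. *)
have /ex_minnP[k kx kmin] : exists k, pi <= k%:R * x by exists n.
have k3 : (2 < k)%N.
  have p0 := @pi_gt0 R.
  by rewrite -(ltr_nat R) -(ltr_pM2r x0) (lt_le_trans _ kx) //; lra.
have Lx : k.-1%:R * x < pi.
  by rewrite ltNge; apply/negP => /kmin; rewrite leqNgt prednK ?leqnn // (leq_trans _ k3).
have Lx2 : 1 / 2 <= k.-1%:R * x.
  have : k%:R * x = k.-1%:R * x + x by rewrite -{1}(prednK (ltnW (ltnW k3))) -natr1 mulrDl mul1r.
  by have := @pi_ge2 R; lra.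
have kn : (k <= n)%N by exact: kmin.
exists ((n %/ k.-1) * k.-1./2)%N; split.
  have := divn_eq n k.-1; have := ltn_pmod n (_ : 0 < k.-1)%N.
  have : (0 < n %/ k.-1)%N by rewrite divn_gt0; lia.
  move: (n %/ k.-1)%N (n %% k.-1)%N => q r q0 /(_ _) r0 e.
  have {}r0 : (r < k.-1)%N by apply: r0; lia.
  have h : (k.-1 <= 3 * k.-1./2)%N by lia.
  have : (q * k.-1 <= q * (3 * k.-1./2))%N by rewrite leq_mul2l h orbT.
  have : (k.-1 <= q * k.-1)%N by rewrite leq_pmull.
  by move: e r0; rewrite mulnCA; move: (q * k.-1)%N (q * _)%N => s1 s2; lia.
move=> theta; apply: le_trans (weaken _ _ Lx2).
by rewrite {1}(divn_eq n k.-1); exact: cosine_bound_blocks.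
Qed.

(** 216 = 18 * 4 * 3: the block bound gives 18, [pair_rate y] <= exp(-y/4) gives 4, and [n./2] >=
    n/3 gives 3. *)
Lemma cosine_bound_near n x : (2 <= n)%N -> 0 < x -> n%:R * x <= 1 / 2 ->
  cosine_bound n x (expR (- (n%:R ^+ 3 * x ^+ 2 / 216))).
Proof.
move=> n2 x0 nx theta.
have nxpi : n%:R * x < pi by have := @pi_ge2 R; lra.
apply: le_trans (cosine_bound_block x0 nxpi theta) _.
set y := _ / 18.
have y0 : 0 <= y by rewrite divr_ge0 ?sqr_ge0.
have y1 : y <= 1.
  have : 0 <= n%:R * x by rewrite mulr_ge0 // ltW.
  by rewrite /y; nra.
apply: le_trans (_ : expR (- (y / 4)) ^+ n./2 <= _).
  rewrite lerXn2r ?nnegrE ?pair_rate_ge0 ?expR_ge0 //.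
  apply: le_trans (expR_ge1Dx _).
  (* Here exp(-y) <= 1/(1 + y) <= 1 - y/2, as y is in [0, 1]. *)
  have : expR (- y) <= 1 - y / 2; last by rewrite /pair_rate; lra.
  rewrite expRN invf_ple ?posrE ?expR_gt0 //; last by lra.
  apply: le_trans (expR_ge1Dx _).
  rewrite -[_^-1]mul1r ler_pdivrMr; last by lra.
  nra.
rewrite -expRM_natr ler_expR.
have : n%:R <= 3 * n./2%:R :> R by rewrite -natrM ler_nat; lia.
rewrite (_ : n%:R ^+ 3 * x ^+ 2 / 216 = y / 12 * n%:R); last by rewrite /y; field.
by nra.
Qed.

End CharacteristicBounds.

(** * Gaussian approximation *)

Section GaussianApproximation.
Context {R : realType} {m : nat}.
Implicit Types (u : {ffun 'I_m -> nat}) (w : seq 'I_m) (n : nat) (x y theta : R).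
Hypothesis m_ge2 : (2 <= m)%N.

Let m_ge2R : (2 : R) <= m%:R.
Proof. by rewrite ler_nat. Qed.

Lemma cos_lipschitz (a b : R) : `|cos a - cos b| <= `|a - b|.
Proof.
wlog ab : a b / a <= b.
  move=> h; have [/h //|/ltW /h] := leP a b.
  by rewrite distrC (distrC b).
rewrite [`|a - b|]distrC (ger0_norm (_ : 0 <= b - a)) ?subr_ge0 // ler_norml; apply/andP; split.
  have /= := @ler_is_derive R (fun t => t - cos t) (fun t => 1 + sin t) a b ab.
  rewrite -subr_ge0 => k; suff : 0 <= b - cos b - (a - cos a) by lra.
  apply: k => t _; first by derive; ring.
  by rewrite -lerBlDl sub0r sin_geN1.
have /= := @ler_is_derive R (fun t => t + cos t) (fun t => 1 - sin t) a b ab.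
rewrite -subr_ge0 => k; suff : 0 <= b + cos b - (a + cos a) by lra.
by apply: k => t _; rewrite subr_ge0 sin_le1.
Qed.

Lemma expRN_lipschitz (a b : R) : 0 <= a -> 0 <= b ->
  `|expR (- a) - expR (- b)| <= `|a - b|.
Proof.
wlog ab : a b / a <= b.
  move=> h a0 b0; have [ab|/ltW ba] := leP a b; first exact: h.
  by rewrite distrC (distrC a); exact: h.
move=> a0 b0; rewrite ger0_norm ?subr_ge0 ?ler_expR ?lerN2 //.
rewrite (distrC a) ger0_norm ?subr_ge0 //.
have /= := @ler_is_derive R (fun t => t + expR (- t)) (fun t => 1 - expR (- t)) a b ab.
rewrite -subr_ge0 => k; suff : 0 <= b + expR (- b) - (a + expR (- a)) by lra.
apply: k => t /andP[at0 _]; first by derive; rewrite ?mulrN1.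
by rewrite subr_ge0 expR_le1 oppr_le0 (le_trans a0).
Qed.

Definition content_variance n u : R := sum_squares u - n%:R ^+ 2 / m%:R.

(** Prepending [a] raises the sum of squares by 1 + 2 u_a. The u_a add up to n, so the mean over [a]
    is 1 + 2n/m for every single word. *)
Lemma average_sum_squares n :
  average n (fun w => sum_squares (content w)) =
  n%:R + n%:R * (n%:R - 1) / m%:R :> R.
Proof.
have m0 : (m%:R : R) != 0 by rewrite pnatr_eq0 -lt0n ltnW.
elim: n => [|n IHn].
  by rewrite average0 mul0r mul0r addr0 /sum_squares big1 // => i _; rewrite ffunE expr0n.
have step (a : 'I_m) w : sum_squares (content (a :: w)) =
    sum_squares (content w) + 1 + 2 * (content w a)%:R :> R.
  rewrite /sum_squares (bigD1 a) //= [in RHS](bigD1 a) //= content_cons eqxx.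
  rewrite (eq_bigr (fun i => (content w i)%:R ^+ 2)) => [|i /negPf ia]; last first.
    by rewrite content_cons ia add0n.
  by rewrite -[true : nat]/1%N natrD; ring.
rewrite averageS -average_sum -averageZ.
transitivity (average n (fun w : seq 'I_m =>
    sum_squares (content w) + (1 + 2 * n%:R / m%:R)) : R).
  apply: eq_average => w wn; under eq_bigr do rewrite step.
  rewrite big_split /= sumr_const card_ord -mulr_sumr (sum_contentR (sum_content w)) wn.
  by rewrite -[_ *+ m]mulr_natr; field.
by rewrite averageD average_cst ?(ltnW m_ge2) // IHn -natr1; field.
Qed.

Lemma average_content_variance n :
  average n (fun w => content_variance n (content w)) <= n%:R :> R.
Proof.
rewrite averageB average_sum_squares average_cst ?(ltnW m_ge2) //.
have -> : n%:R + n%:R * (n%:R - 1) / m%:R - n%:R ^+ 2 / m%:R = n%:R - n%:R / m%:R :> R.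
  by field; rewrite pnatr_eq0 -lt0n ltnW.
by rewrite gerBl divr_ge0.
Qed.

Lemma content_varianceE n u : (\sum_(i < m) u i)%N = n ->
  content_variance n u = \sum_(i < m) ((u i)%:R - n%:R / m%:R) ^+ 2.
Proof.
move=> un; have m0 : (m%:R : R) != 0 by rewrite pnatr_eq0 -lt0n ltnW.
rewrite (eq_bigr (fun i => (u i)%:R ^+ 2 - 2 * (n%:R / m%:R) * (u i)%:R +
  (n%:R / m%:R) ^+ 2)) => [|i _]; last by ring.
rewrite big_split sumrB /= -mulr_sumr (sum_contentR un) sumr_const card_ord.
by rewrite -[_ *+ m]mulr_natr /content_variance /sum_squares; field.
Qed.

Lemma content_variance_ge0 n u : (\sum_(i < m) u i)%N = n -> 0 <= content_variance n u.
Proof. by move=> un; rewrite (content_varianceE un) sumr_ge0 // => i _; exact: sqr_ge0. Qed.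

(** Expansion around n/m: the linear term vanishes because the deviations add up to 0, the quadratic
    one is 3n/m times the variance, and in the cubic one each deviation is at most n. *)
Lemma sum_cubes_dist n u : (\sum_(i < m) u i)%N = n ->
  `|\sum_(i < m) (u i)%:R ^+ 3 - n%:R ^+ 3 / m%:R ^+ 2| <= 4 * n%:R * content_variance n u.
Proof.
move=> un; have m0 : (m%:R : R) != 0 by rewrite pnatr_eq0 -lt0n ltnW.
have nm : n%:R / m%:R <= n%:R :> R.
  by rewrite ler_piMr // invf_le1 ?(lt_le_trans _ m_ge2R) // (le_trans _ m_ge2R) // ler1n.
have nm0 : 0 <= n%:R / m%:R :> R by rewrite divr_ge0.
pose d i : R := (u i)%:R - n%:R / m%:R.
have -> : \sum_(i < m) (u i)%:R ^+ 3 - n%:R ^+ 3 / m%:R ^+ 2 =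
    3 * (n%:R / m%:R) * content_variance n u + \sum_(i < m) d i ^+ 3.
  rewrite (content_varianceE un) mulr_sumr -big_split /=.
  rewrite [RHS](eq_bigr (fun i => (u i)%:R ^+ 3 - 3 * (n%:R / m%:R) ^+ 2 * (u i)%:R +
     2 * (n%:R / m%:R) ^+ 3)) => [|i _]; last by rewrite /d; ring.
  rewrite big_split sumrB /= -mulr_sumr (sum_contentR un) sumr_const card_ord.
  by rewrite -[_ *+ m]mulr_natr; field.
apply: le_trans (ler_normD _ _) _.
have v0 := content_variance_ge0 un.
rewrite ger0_norm; last by rewrite !mulr_ge0.
have -> : 4 * n%:R * content_variance n u =
  3 * n%:R * content_variance n u + n%:R * content_variance n u by ring.
apply: lerD; first by rewrite ler_wpM2r // ler_wpM2l.
apply: le_trans (ler_norm_sum _ _ _) _; rewrite (content_varianceE un) mulr_sumr.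
apply: ler_sum => i _; rewrite exprS normrM (ger0_norm (sqr_ge0 _)) ler_wpM2r ?sqr_ge0 //.
have : (u i)%:R <= n%:R :> R by rewrite ler_nat (content_le _ un).
have : 0 <= (u i)%:R :> R by [].
by move=> ? ?; rewrite ler_norml /d; apply/andP; split; lra.
Qed.

Lemma galois_var_bar_ge0 n : 0 <= galois_var_bar n m :> R.
Proof.
rewrite mulr_ge0 ?exprn_ge0 // divr_ge0 //; first by move: (m%:R : R) m_ge2R => M; nra.
Qed.

(** Three errors occur: the ratio against 1, the exponent and the phase against their values at u_i
    = n/m. The last two are bounded by affine functions of [content_variance], so only its mean is
    needed. *)
Lemma cosine_gaussian_bar n x theta : (1 <= n)%N -> 0 < x -> n%:R * x < pi ->
  `|average n (fun w : seq 'I_m => cos (2 * x * (inversions w)%:R + theta))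
    - cos (2 * x * galois_mean_bar n m + theta)
      * expR (- (2 * x ^+ 2 * galois_var_bar n m))| <=
  n%:R ^+ 5 * x ^+ 4 + n%:R ^+ 2 * x ^+ 2 + n%:R * x.
Proof.
move=> n1 x0 nx; have m0 : (m%:R : R) != 0 by rewrite pnatr_eq0 -lt0n ltnW.
rewrite (conditional_average (fun=> theta)) //.
set g := cos _ * expR _.
rewrite -[g](average_cst (ltnW m_ge2) n) -averageB.
apply: le_trans (ler_norm_average _ _) _.
pose err (w : seq 'I_m) : R := n%:R ^+ 5 * x ^+ 4 + n%:R ^+ 2 * x ^+ 2 / 12
  + (2 * x ^+ 2 * n%:R / 9 + x / 2) * content_variance n (content w).
apply: le_trans (_ : average n err <= _); last first.
  rewrite averageD averageZ average_cst ?(ltnW m_ge2) //.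
  have := average_content_variance n.
  set V := average _ _ => Vn.
  have : (2 * x ^+ 2 * n%:R / 9 + x / 2) * V <= (2 * x ^+ 2 * n%:R / 9 + x / 2) * n%:R.
    by rewrite ler_wpM2l // addr_ge0 ?divr_ge0 ?mulr_ge0 ?sqr_ge0 // ltW.
  have : 0 <= n%:R ^+ 2 * x ^+ 2 by rewrite mulr_ge0 ?sqr_ge0.
  have : 0 <= n%:R * x by rewrite mulr_ge0 // ltW.
  rewrite (_ : (_ + x / 2) * n%:R = 2 * (n%:R ^+ 2 * x ^+ 2) / 9 + n%:R * x / 2); last by field.
  by move: ((_ + x / 2) * V) (n%:R ^+ 2 * x ^+ 2) (n%:R * x) => A B C; lra.
apply: ler_average => w wn; have un := sum_content w; rewrite wn in un.
rewrite /err; move: (content w) un => u un {err wn w}.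
have v0 := content_variance_ge0 un.
have D0 : 0 <= pyramid_defect n u :> R.
  apply: le_trans (pyramid_defect_ge un).
  by rewrite divr_ge0 ?mulr_ge0 // subr_ge0 sum_squares_le.
have x20 : 0 <= x ^+ 2 by exact: sqr_ge0.
set a := x ^+ 2 / 6 * pyramid_defect n u.
set b := 2 * x ^+ 2 * galois_var_bar n m.
have a0 : 0 <= a by rewrite mulr_ge0 ?divr_ge0.
have b0 : 0 <= b by rewrite mulr_ge0 ?galois_var_bar_ge0 // mulr_ge0.
have ab : `|a - b| <= n%:R ^+ 2 * x ^+ 2 / 12 + 2 * x ^+ 2 * n%:R / 9 * content_variance n u.
  have -> : a - b = x ^+ 2 / 6 * ((n%:R ^+ 2 - sum_squares u) / 2 -
      (\sum_(i < m) (u i)%:R ^+ 3 - n%:R ^+ 3 / m%:R ^+ 2) / 3).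
    by rewrite /a /b (pyramid_defectE un) /galois_var_bar; field.
  rewrite normrM ger0_norm ?divr_ge0 //.
  have := sum_cubes_dist un; have := sum_squares_le (R := R) un.
  have : 0 <= sum_squares u :> R by apply: sumr_ge0 => i _; exact: sqr_ge0.
  set C := _ - _ / _; set q := sum_squares u; set v := content_variance n u.
  move=> q0 qn; rewrite ler_norml => /andP[C1 C2].
  rewrite (_ : _ + _ = x ^+ 2 / 6 * (n%:R ^+ 2 / 2 + 4 * n%:R * v / 3)); last by field.
  rewrite ler_wpM2l ?divr_ge0 // ler_norml.
  by move: (4 * n%:R * v) C1 C2 => K C1 C2; apply/andP; split; lra.
set p := x * (n%:R ^+ 2 - sum_squares u) / 2 + theta.
set p' := 2 * x * galois_mean_bar n m + theta.
have pp : `|p - p'| <= x / 2 * content_variance n u.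
  have -> : p - p' = - (x / 2 * content_variance n u).
    by rewrite /p /p' /content_variance /galois_mean_bar; field.
  by rewrite normrN ger0_norm // mulr_ge0 // divr_ge0 // ltW.
rewrite /conditional_factor -/a /g -/b -/p'.
have r1 := gauss_sinc_ratio_le1 x0 nx un.
have r2 := gauss_sinc_ratio_ge x0 nx un.
have K0 : 0 <= n%:R ^+ 5 * x ^+ 4 by rewrite mulr_ge0 ?exprn_ge0 // ltW.
move: (gauss_sinc_ratio x n u) r1 r2 => r r1 r2.
have -> : r * expR (- a) * cos p - cos p' * expR (- b) =
  (r - 1) * (expR (- a) * cos p) + (expR (- a) - expR (- b)) * cos p +
  expR (- b) * (cos p - cos p') by ring.
have ea : expR (- a) <= 1 by rewrite expR_le1 oppr_le0.
have eb : expR (- b) <= 1 by rewrite expR_le1 oppr_le0.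
have h1 : `|(r - 1) * (expR (- a) * cos p)| <= n%:R ^+ 5 * x ^+ 4.
  rewrite normrM -[X in _ <= X]mulr1 ler_pM //.
    by rewrite ler_norml; apply/andP; split; lra.
  by rewrite normrM -[X in _ <= X]mulr1 ler_pM ?cos_max // ger0_norm ?expR_ge0.
have h2 : `|(expR (- a) - expR (- b)) * cos p| <= `|a - b|.
  by rewrite normrM -[X in _ <= X]mulr1 ler_pM ?cos_max // expRN_lipschitz.
have h3 : `|expR (- b) * (cos p - cos p')| <= `|p - p'|.
  by rewrite normrM -[X in _ <= X]mul1r ler_pM ?cos_lipschitz // ger0_norm ?expR_ge0.
apply: le_trans (ler_normD _ _) _.
apply: le_trans (lerD (ler_normD _ _) (lexx _)) _.
lra.
Qed.

(** Transfers the comparison from the barred parameters to nearby ones. *)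
Lemma gaussian_dist x theta (mu1 mu2 s1 s2 : R) : 0 <= x -> 0 <= s1 -> 0 <= s2 ->
  `|cos (2 * x * mu1 + theta) * expR (- (2 * x ^+ 2 * s1))
    - cos (2 * x * mu2 + theta) * expR (- (2 * x ^+ 2 * s2))| <=
  2 * x * `|mu1 - mu2| + 2 * x ^+ 2 * `|s1 - s2|.
Proof.
move=> x0 s10 s20.
have h1 := cos_lipschitz (2 * x * mu1 + theta) (2 * x * mu2 + theta).
have x2 : 0 <= 2 * x ^+ 2 by rewrite mulr_ge0 ?sqr_ge0.
have h2 := expRN_lipschitz (mulr_ge0 x2 s10) (mulr_ge0 x2 s20).
move: h1 h2; rewrite -mulrBr normrM (ger0_norm x2).
rewrite (_ : 2 * x * mu1 + theta - _ = 2 * x * (mu1 - mu2)); last by ring.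
rewrite normrM (ger0_norm (_ : 0 <= 2 * x)) ?mulr_ge0 //.
set c1 := cos _; set c2 := cos _; set e1 := expR _; set e2 := expR _ => h1 h2.
have -> : c1 * e1 - c2 * e2 = (c1 - c2) * e1 + c2 * (e1 - e2) by ring.
apply: le_trans (ler_normD _ _) _; rewrite !normrM; apply: lerD.
  rewrite -[X in _ <= X]mulr1 ler_pM // ger0_norm ?expR_ge0 //.
  by rewrite expR_le1 oppr_le0 mulr_ge0.
by rewrite -[X in _ <= X]mul1r ler_pM // cos_max.
Qed.

End GaussianApproximation.

(** * From the generating function to the distribution *)

Section PolynomialPGF.
Context {R : realType} d (T : measurableType d) (P : probability T R).
Variable X : {RV P >-> nat}.
Implicit Types (f : nat -> R) (K : nat).

Let A (j : nat) : set T := [set w | X w = j].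

Let p (j : nat) : R := fine (P (A j)).

Let measurable_A j : measurable (A j).
Proof. by rewrite -[A j]/(X @^-1` [set j]); exact: measurable_funPTI. Qed.

Let PA j : P (A j) = (p j)%:E.
Proof. by rewrite fineK // fin_num_measure. Qed.

Let measurable_funX f : measurable_fun [set: T] (fun w => (f (X w))%:E).
Proof.
apply/measurable_EFinP; apply: (measurableT_comp (f := f) (g := X)) => //.
Qed.

Let simple f K (w : T) : R := \sum_(j < K) f j * \1_(A j) w.

Let simpleE f K w : simple f K w = if (X w < K)%N then f (X w) else 0.
Proof.
case: ltnP => XK.
  rewrite /simple (bigD1 (Ordinal XK)) //= indicE mem_set // mulr1 big1 ?addr0 // => j jX.
  rewrite indicE memNset ?mulr0 // => e; move/eqP: jX; apply; exact/val_inj.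
rewrite /simple big1 // => j _; rewrite indicE memNset ?mulr0 // => e.
by have := ltn_ord j; rewrite -e ltnNge XK.
Qed.

Let measurable_simple f K : measurable_fun [set: T] (fun w => (simple f K w)%:E).
Proof.
rewrite (_ : (fun w => _) = (fun w => ((fun j => if (j < K)%N then f j else 0) (X w))%:E)).
  exact: (measurable_funX (fun j => if (j < K)%N then f j else 0)).
by apply/funext => w; rewrite simpleE.
Qed.

Let integral_simple f K : (forall j, 0 <= f j) ->
  (\int[P]_w (simple f K w)%:E = (\sum_(j < K) f j * p j)%:E)%E.
Proof.
move=> f0; under eq_integral do rewrite /simple -sumEFin.
rewrite ge0_integral_sum //; last first.
- by move=> j w _; rewrite lee_fin mulr_ge0.
- move=> j; apply/measurable_EFinP; apply: measurable_funM => //.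
rewrite -sumEFin; apply: eq_bigr => j _.
rewrite (integralZl_indic _ (fun=> A j)) //; last by move=> /lt_geF; rewrite f0.
rewrite EFinM; congr (_ * _)%E; rewrite integral_indic // setIT; exact: PA.
Qed.

Let integral_cstE (c : R) : (\int[P]_w c%:E = c%:E)%E.
Proof.
rewrite integral_cst // [X in (_ * X)%E](_ : _ = 1%E) ?mule1 //.
exact: probability_setT.
Qed.

(** Only q in [0, 1] is available, so the coefficients are read off one at a time as q tends to 0:
    once the lower ones agree, dividing by q^k leaves a discrepancy of order q. *)
Lemma pgf_coefficient (g : {poly R}) k : has_pgf X g -> p k = g`_k.
Proof.
move=> hg; have [n] := ubnP k; elim: n k => // n IHn k; rewrite ltnS => kn.
have IH (j : 'I_k) : p j = g`_j by apply: IHn; exact: leq_trans (ltn_ord j) kn.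
pose r := drop_poly k.+1 g.
(* The 1 pays for the event X > k, which contributes at most q^(k+1); the sum bounds the remainder
   [r] on [0, 1]. *)
pose B := 1 + \sum_(j < size r) `|r`_j|.
have B0 : 0 < B by rewrite ltr_pwDl // sumr_ge0.
have key q : 0 < q -> q <= 1 -> `|p k - g`_k| <= q * B.
  move=> q0 q1; have q01 : 0 <= q <= 1 by rewrite ltW.
  have rB : `|r.[q]| <= B - 1.
    rewrite /B addrAC subrr add0r horner_coef; apply: le_trans (ler_norm_sum _ _ _) _.
    apply: ler_sum => j _; rewrite normrM ler_piMr // normrX (ger0_norm (ltW q0)).
    by rewrite exprn_ile1 // ltW.
  have gE : g.[q] = \sum_(j < k) g`_j * q ^+ j + g`_k * q ^+ k + q ^+ k.+1 * r.[q].
    rewrite -{1}(poly_take_drop k.+1 g) hornerD hornerM hornerXn mulrC -/r; congr (_ + _).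
    rewrite (horner_coef_wide _ (size_take_poly k.+1 g)) big_ord_recr /=.
    rewrite coef_take_poly ltnSn; congr (_ + _); apply: eq_bigr => j _.
    by rewrite coef_take_poly ltnS ltnW.
  have SE : \sum_(j < k.+1) q ^+ j * p j = \sum_(j < k) g`_j * q ^+ j + p k * q ^+ k.
    rewrite big_ord_recr /= [q ^+ k * _]mulrC; congr (_ + _).
    by apply: eq_bigr => j _; rewrite IH mulrC.
  have lo : \sum_(j < k.+1) q ^+ j * p j <= g.[q].
    rewrite -lee_fin -(integral_simple k.+1); last by move=> j; rewrite exprn_ge0 // ltW.
    rewrite -(hg q q01) expectation.unlock; apply: ge0_le_integral => //.
    - by move=> w _; rewrite lee_fin simpleE; case: ifP; rewrite ?exprn_ge0 // ltW.
    - by move=> w _; rewrite lee_fin simpleE; case: ifP; rewrite // exprn_ge0 // ltW.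
  have hi : g.[q] <= \sum_(j < k.+1) q ^+ j * p j + q ^+ k.+1.
    rewrite -lee_fin EFinD -(integral_simple k.+1); last by move=> j; rewrite exprn_ge0 // ltW.
    have -> : (q ^+ k.+1)%:E = (\int[P]_w (q ^+ k.+1)%:E)%E.
      by rewrite integral_cstE.
    rewrite -ge0_integralD //; last first.
    - by move=> w _; rewrite lee_fin exprn_ge0 // ltW.
    - by move=> w _; rewrite lee_fin simpleE; case: ifP; rewrite ?exprn_ge0 // ltW.
    rewrite -(hg q q01) expectation.unlock; apply: ge0_le_integral => //.
    - by move=> w _; rewrite lee_fin exprn_ge0 // ltW.
    - by apply: emeasurable_funD.
    - move=> w _; rewrite -EFinD lee_fin simpleE; case: ltnP => h.
        by rewrite lerDl exprn_ge0 // ltW.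
      by rewrite add0r ler_wiXn2l // ltW.
  have qk : 0 < q ^+ k by rewrite exprn_gt0.
  rewrite -(ler_pM2r qk) -{1}(gtr0_norm qk) -normrM mulrBl.
  move: lo hi; rewrite gE SE exprS => lo hi.
  move: rB; rewrite ler_norml => /andP[r1 r2].
  have qq : 0 <= q * q ^+ k by rewrite mulr_ge0 ?ltW.
  rewrite mulrAC ler_norml; apply/andP; split; nra.
apply/eqP; rewrite -subr_eq0 -normr_le0; apply/ler_addgt0Pr => e e0; rewrite add0r.
pose q := Num.min 1 (e / B).
have q0 : 0 < q by rewrite lt_min ltr01 divr_gt0.
apply: le_trans (key q q0 _) _; first by rewrite ge_min lexx.
by rewrite -ler_pdivlMr // ge_min lexx orbT.
Qed.

(** At q = 1 the coefficients add up to 1, so [X] is almost surely less than [size g] and the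
    expectation is a finite sum. *)
Lemma pgf_expectation (g : {poly R}) f : has_pgf X g -> (forall j, 0 <= f j) ->
  (\int[P]_w (f (X w))%:E = (\sum_(j < size g) f j * g`_j)%:E)%E.
Proof.
move=> hg f0.
have sum1 : \sum_(j < size g) p j = 1.
  have /hg : 0 <= (1 : R) <= 1 by rewrite ler01 lexx.
  rewrite expectation.unlock; under eq_integral do rewrite expr1n.
  rewrite integral_cstE horner_coef => -[->].
  by apply: eq_bigr => j _; rewrite expr1n mulr1 (pgf_coefficient j hg).
rewrite (eq_bigr (fun j : 'I__ => f j * p j)) => [|j _]; last by rewrite (pgf_coefficient j hg).
rewrite -integral_simple //; apply: ge0_ae_eq_integral => //.
- by move=> w _; rewrite lee_fin.
- by move=> w _; rewrite lee_fin simpleE; case: ifP.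
exists [set w | (size g <= X w)%N]; split.
- by rewrite (_ : mkset _ = X @^-1` [set j | (size g <= j)%N]) //; exact: measurable_funPTI.
- have mB : measurable [set w | (X w < size g)%N].
    by rewrite (_ : mkset _ = X @^-1` [set j | (j < size g)%N]) //; exact: measurable_funPTI.
  have PB : P [set w | (X w < size g)%N] = 1%:E.
    have := integral_simple (f := fun=> 1) (size g) (fun=> ler01).
    under [X in _ = X%:E -> _]eq_bigr do rewrite mul1r.
    rewrite sum1 => <-; rewrite -[X in P X]setIT -integral_indic //.
    apply: eq_integral => w _; rewrite simpleE indicE; case: ifP => h; first by rewrite mem_set.
    by rewrite memNset //= h.
  rewrite (_ : mkset _ = ~` [set w | (X w < size g)%N]).
    by have := probability_setC P mB; rewrite PB subee //; apply.
  apply/seteqP; split => w /= h; first by apply/negP; rewrite -leqNgt.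
  by rewrite leqNgt; apply/negP.
move=> w /= h; apply: contrapT => hX; apply: h => _.
by rewrite simpleE; move/negP: hX; rewrite -ltnNge => ->.
Qed.

End PolynomialPGF.

(** * Fourier transform of the Gaussian *)

Section ContinuousIntegral.
Context {R : realType}.
Implicit Types (f g : R -> R) (a b c x : R).

Definition integral_on f a b : R := \int[@lebesgue_measure R]_(x in `[a, b]) f x.

Lemma continuous_integrable f a b : continuous f ->
  (@lebesgue_measure R).-integrable `[a, b] (EFin \o f).
Proof.
move=> cf; apply: continuous_compact_integrable; first exact: segment_compact.
exact: continuous_subspaceT.
Qed.

Lemma integral_onD f g a b : continuous f -> continuous g ->
  integral_on (fun x => f x + g x) a b = integral_on f a b + integral_on g a b.
Proof. by move=> cf cg; apply: RintegralD => //; exact: continuous_integrable. Qed.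

Lemma integral_onZ c f a b : continuous f ->
  integral_on (fun x => c * f x) a b = c * integral_on f a b.
Proof. by move=> cf; apply: RintegralZl => //; exact: continuous_integrable. Qed.

Lemma integral_onB f g a b : continuous f -> continuous g ->
  integral_on (fun x => f x - g x) a b = integral_on f a b - integral_on g a b.
Proof. by move=> cf cg; apply: RintegralB => //; exact: continuous_integrable. Qed.

Lemma integral_on_split f a b c : continuous f -> a <= b -> b <= c ->
  integral_on f a c = integral_on f a b + integral_on f b c.
Proof.
move=> cf ab bc; have := @Rintegral_itvB R f (BLeft a) (BRight c) b
  (continuous_integrable a c cf).
rewrite !bnd_simp => /(_ ab bc) => h.
apply/eqP; rewrite -subr_eq0 opprD addrA; apply/eqP.
rewrite /integral_on h -Rintegral_itv_obnd_cbnd ?subrr //.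
apply: integrableS (continuous_integrable b c cf) => //.
exact: subset_itv_oc_cc.
Qed.

(** The open interval matters: the bounds on the character are available for 0 < x and c x < pi
    only, both strict. *)
Lemma norm_integral_on_le f g a b : continuous f -> continuous g -> a <= b ->
  (forall x, a < x -> x < b -> `|f x| <= g x) ->
  `|integral_on f a b| <= integral_on g a b.
Proof.
move=> cf cg ab fg.
have I h : continuous h -> (@lebesgue_measure R).-integrable `]a, b[ (EFin \o h).
  move=> ch; apply: integrableS (continuous_integrable a b ch) => //.
  exact: subset_itv_oo_cc.
have E h : continuous h -> integral_on h a b = \int[@lebesgue_measure R]_(x in `]a, b[) h x.
  move=> ch; rewrite /integral_on -Rintegral_itv_obnd_cbnd -?Rintegral_itv_bndo_bndc //.
    exact: I.
  apply: integrableS (continuous_integrable a b ch) => //.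
  exact: subset_itv_oc_cc.
rewrite !E //; apply: le_trans (le_normr_Rintegral _ (I _ cf)) _ => //.
apply: le_Rintegral => //; last by move=> x /=; rewrite in_itv /= => /andP[]; exact: fg.
  apply: (I (fun x => `|f x|)) => x.
  by apply: continuous_comp; [exact: cf | exact: norm_continuous].
exact: I.
Qed.

Lemma is_derive_continuous f df : (forall x, is_derive x 1 f (df x)) -> continuous f.
Proof.
by move=> h x; apply: differentiable_continuous; apply/derivable1_diffP; have [] := h x.
Qed.

Lemma integral_on_FTC F f a b : continuous f -> a <= b ->
  (forall x, is_derive x 1 F (f x)) -> integral_on f a b = F b - F a.
Proof.
move=> cf; rewrite le_eqVlt => /predU1P[-> _|ab dF].
  by rewrite /integral_on set_itv1 Rintegral_set1 subrr.
have cF : continuous F by exact: is_derive_continuous dF.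
rewrite /integral_on /Rintegral (@continuous_FTC2 R f F a b ab) //.
- exact: continuous_subspaceT.
- split; first by move=> x _; have [] := dF x.
    exact: cvg_at_right_filter (cF a).
  exact: cvg_at_left_filter (cF b).
by move=> x _; rewrite derive1E; have [_] := dF x.
Qed.

Lemma integral_on_cst c a b : a <= b -> integral_on (fun=> c) a b = c * (b - a).
Proof.
move=> ab; have dF (x : R) : is_derive x 1 (fun x => c * x) c by derive; rewrite mulr1 mulr0 addr0.
by rewrite (integral_on_FTC _ ab dF) ?mulrBr //; exact: cst_continuous.
Qed.

End ContinuousIntegral.

(** * The truncated Fourier integral and its differential equation *)

Section GaussianFourier.
Context {R : realType}.
Implicit Types (a b x A : R).

Lemma continuous_cos_gauss b : continuous (fun x : R => cos (b * x) * expR (- x ^+ 2)).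
Proof. by apply: is_derive_continuous => x; derive. Qed.

Lemma continuous_sin_gauss b : continuous (fun x : R => x * (sin (b * x) * expR (- x ^+ 2))).
Proof. by apply: is_derive_continuous => x; derive. Qed.

Definition gauss_fourier A b : R := integral_on (fun x => cos (b * x) * expR (- x ^+ 2)) 0 A.

Lemma cos_taylor a h : `|cos (a + h) - cos a + h * sin a| <= h ^+ 2.
Proof.
have sin_dist (t : R) : 0 <= t -> t - sin t <= t ^+ 2 / 2.
  move=> t0; rewrite -subr_ge0.
  have c1 (s : R) : 0 <= s -> 0 <= s - 1 + cos s.
    move=> s0; have /= := @ler_is_derive R (fun r => r - 1 + cos r) (fun r => 1 - sin r) 0 s s0.
    rewrite cos0 add0r addNr; apply=> r _; last by rewrite subr_ge0 sin_le1.
    by derive; ring.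
  have /= := @ler_is_derive R (fun r => r ^+ 2 * 2^-1 - (r - sin r))
    (fun r => r - 1 + cos r) 0 t t0.
  rewrite sin0 expr0n mul0r !subr0; apply=> r /andP[r0 _]; last exact: c1.
  by derive; rewrite /=; field.
have -> : cos (a + h) - cos a + h * sin a =
  - cos a * (1 - cos h) + sin a * (h - sin h) by rewrite cosD; ring.
apply: le_trans (ler_normD _ _) _; rewrite !normrM normrN.
have h1 : `|1 - cos h| <= h ^+ 2 / 2.
  rewrite -cos_norm ger0_norm ?subr_ge0 ?cos_le1 //.
  by have := cos_ge (normr_ge0 h); rewrite real_normK ?num_real //; lra.
have h2 : `|h - sin h| <= h ^+ 2 / 2.
  wlog h0 : h {h1} / 0 <= h.
    move=> k; have [/k //|/ltW h0] := leP 0 h.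
    by have := k (- h); rewrite sinN -opprD normrN sqrrN oppr_ge0; apply.
  by rewrite ger0_norm ?sin_dist // subr_ge0 sin_le.
have c1 := cos_max a; have s1 := sin_max a.
have : `|cos a| * `|1 - cos h| <= h ^+ 2 / 2 by rewrite (le_trans _ h1) // ler_piMl.
have : `|sin a| * `|h - sin h| <= h ^+ 2 / 2 by rewrite (le_trans _ h2) // ler_piMl.
lra.
Qed.

(** With a quadratic error, differentiation under the integral sign reduces to a pointwise Taylor
    bound. *)
Lemma is_derive_quadratic (F : R -> R) b D C : 0 <= C ->
  (forall h, `|F (b + h) - F b - h * D| <= C * h ^+ 2) -> is_derive b 1 F D.
Proof.
move=> C0 H.
have cv : h^-1 *: (F (h *: 1 + b) - F b) @[h --> 0^'] --> D.
  apply/cvgrPdist_le => e e0; near=> h.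
  have h0 : h != 0 by near: h; exact: nbhs_dnbhs_neq.
  have he : `|h| <= e / (C + 1).
    near: h; apply: dnbhs0_le; rewrite divr_gt0 //; lra.
  rewrite distrC (_ : _ - D = h^-1 * (F (b + h) - F b - h * D)); last first.
    by rewrite /GRing.scale /= mulr1 (addrC h); field.
  rewrite normrM normfV ler_pdivrMl ?normr_gt0 //; apply: le_trans (H h) _.
  rewrite -(real_normK (num_real h)) expr2 mulrCA ler_wpM2l //.
  move: he; rewrite ler_pdivlMr; last by lra.
  by have := normr_ge0 h; nra.
split; first by apply/cvg_ex; exists D.
exact/cvg_lim.
Unshelve. all: by end_near.
Qed.

Lemma is_derive_gauss_fourier A b : 0 <= A ->
  is_derive b 1 (gauss_fourier A)
    (- (b / 2) * gauss_fourier A b + sin (b * A) * expR (- A ^+ 2) / 2).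
Proof.
move=> A0.
pose S := integral_on (fun x : R => x * (sin (b * x) * expR (- x ^+ 2))) 0 A.
(* Integration by parts gives F' = -(b/2) F up to a boundary term at [A]. *)
have byparts : sin (b * A) * expR (- A ^+ 2) = b * gauss_fourier A b - 2 * S.
  have cc := @continuous_cos_gauss b; have cs := @continuous_sin_gauss b.
  have cbc : continuous (fun x : R => b * (cos (b * x) * expR (- x ^+ 2))).
    by apply: is_derive_continuous => x; derive.
  have cbs : continuous (fun x : R => 2 * (x * (sin (b * x) * expR (- x ^+ 2)))).
    by apply: is_derive_continuous => x; derive.
  rewrite /gauss_fourier /S -!integral_onZ // -integral_onB //.
  have dH (x : R) : is_derive x 1 (fun x => sin (b * x) * expR (- x ^+ 2))
      (b * (cos (b * x) * expR (- x ^+ 2)) - 2 * (x * (sin (b * x) * expR (- x ^+ 2)))).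
    by derive; rewrite /=; ring.
  rewrite (integral_on_FTC _ A0 dH); first by rewrite mulr0 sin0 mul0r subr0.
  by apply: is_derive_continuous => x; derive.
have -> : - (b / 2) * gauss_fourier A b + sin (b * A) * expR (- A ^+ 2) / 2 = - S.
  by rewrite byparts; field.
(* The integrand errs by at most (h x)^2 <= A^2 h^2, over a segment of length [A]. *)
apply: (@is_derive_quadratic _ _ _ (A ^+ 3)); first by rewrite exprn_ge0.
move=> h.
have cbh := @continuous_cos_gauss (b + h); have cb := @continuous_cos_gauss b.
have cs : continuous (fun x : R => h * (x * (sin (b * x) * expR (- x ^+ 2)))).
  by apply: is_derive_continuous => x; derive.
rewrite mulrN opprK /gauss_fourier /S -integral_onZ; last exact: continuous_sin_gauss.
rewrite -integral_onB // -integral_onD //; last by apply: is_derive_continuous => x; derive.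
have -> : A ^+ 3 * h ^+ 2 = integral_on (fun=> A ^+ 2 * h ^+ 2) 0 A.
  by rewrite integral_on_cst // subr0 exprS; ring.
apply: norm_integral_on_le => //.
    by apply: is_derive_continuous => x; derive.
  exact: cst_continuous.
move=> x x0 xA.
have -> : cos ((b + h) * x) * expR (- x ^+ 2) - cos (b * x) * expR (- x ^+ 2) +
    h * (x * (sin (b * x) * expR (- x ^+ 2))) =
  (cos (b * x + h * x) - cos (b * x) + h * x * sin (b * x)) * expR (- x ^+ 2).
  by rewrite mulrDl; ring.
rewrite normrM (ger0_norm (expR_ge0 _)).
apply: le_trans (_ : (h * x) ^+ 2 * 1 <= _).
  by rewrite ler_pM ?cos_taylor ?expR_ge0 // expR_le1 oppr_le0 sqr_ge0.
rewrite mulr1 exprMn mulrC ler_wpM2r ?sqr_ge0 // lerXn2r ?nnegrE //; exact: ltW.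
Qed.

Lemma gauss_fourier_decay A b : 0 <= A ->
  `|gauss_fourier A b - gauss_fourier A 0 * expR (- (b ^+ 2 / 4))| <=
  `|b| * expR (- A ^+ 2).
Proof.
move=> A0.
have even (c : R) : gauss_fourier A (- c) = gauss_fourier A c.
  by rewrite /gauss_fourier; congr (integral_on _ _ _); apply/funext => x; rewrite mulNr cosN.
wlog b0 : b / 0 <= b.
  move=> k; have [/k //|/ltW h0] := leP 0 b.
  by have := k (- b); rewrite even sqrrN normrN oppr_ge0; apply.
(* With this integrating factor, only the boundary term survives in the derivative. *)
pose Q (c : R) := gauss_fourier A c * expR (c ^+ 2 / 4).
have dQ (c : R) : is_derive c 1 Q (expR (c ^+ 2 / 4) * (sin (c * A) * expR (- A ^+ 2) / 2)).
  have dF := is_derive_gauss_fourier c A0.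
  rewrite /Q; derive; first exact: dF.
  by rewrite /=; field.
have cQ : continuous Q by apply: is_derive_continuous dQ.
have [c] := MVT_segment b0 (fun x _ => dQ x) (continuous_subspaceT cQ).
rewrite in_itv /= => /andP[c0 cb].
rewrite /Q expr0n /= mul0r expR0 mulr1 subr0 => e.
have -> : gauss_fourier A b - gauss_fourier A 0 * expR (- (b ^+ 2 / 4)) =
    (gauss_fourier A b * expR (b ^+ 2 / 4) - gauss_fourier A 0) * expR (- (b ^+ 2 / 4)).
  rewrite expRN; field; exact: lt0r_neq0 (expR_gt0 _).
rewrite e !normrM !(ger0_norm (expR_ge0 _)) (ger0_norm b0).
have e1 : expR (c ^+ 2 / 4) * expR (- (b ^+ 2 / 4)) <= 1.
  rewrite -expRD expR_le1 subr_le0 ler_pM2r ?invr_gt0 // lerXn2r ?nnegrE //.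
have s1 := sin_max (c * A).
rewrite (ger0_norm (_ : 0 <= 2^-1)) ?invr_ge0 //.
move: e1 (expR_ge0 (c ^+ 2 / 4)) (expR_ge0 (- (b ^+ 2 / 4))) (expR_ge0 (- A ^+ 2)) s1
  (normr_ge0 (sin (c * A))).
move: (expR (c ^+ 2 / 4)) (expR (- (b ^+ 2 / 4))) (expR (- A ^+ 2)) `|sin (c * A)| => u v w s.
move=> uv u0 v0 w0 s1 s0.
rewrite (_ : _ * v = u * v * (s / 2) * (b * w)); last by ring.
rewrite -[X in _ <= X]mul1r ler_wpM2r ?mulr_ge0 //.
rewrite -[X in _ <= X]mul1r ler_pM ?mulr_ge0 //; lra.
Qed.

(** For x >= A, exp(-x^2) is at most exp(-A x), which has an explicit primitive. *)
Lemma gauss_fourier_tail A B b : 0 < A -> A <= B ->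
  `|gauss_fourier B b - gauss_fourier A b| <= 1 / A.
Proof.
move=> A0 AB.
have cc := @continuous_cos_gauss b.
rewrite /gauss_fourier (integral_on_split cc (ltW A0) AB) addrAC subrr add0r.
have ce : continuous (fun x : R => expR (- (A * x))).
  by apply: is_derive_continuous => x; derive.
apply: le_trans (_ : integral_on (fun x : R => expR (- (A * x))) A B <= _).
  apply: norm_integral_on_le => // x Ax xB.
  rewrite normrM (ger0_norm (expR_ge0 _)) -[X in _ <= X]mul1r.
  by rewrite ler_pM ?cos_max ?expR_ge0 // ler_expR lerN2 expr2 ler_wpM2r // ltW // (lt_trans A0).
have dE (x : R) : is_derive x 1 (fun x => - (A^-1 * expR (- (A * x)))) (expR (- (A * x))).
  by derive; rewrite /=; field; rewrite gt_eqF.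
rewrite (integral_on_FTC ce AB dE) opprK.
have eA : expR (- (A * A)) <= 1 by rewrite expR_le1 oppr_le0 mulr_ge0 // ltW.
have := expR_ge0 (- (A * B)); have iA : 0 < A^-1 by rewrite invr_gt0.
by rewrite mul1r; nra.
Qed.

Lemma gauss_fourier_limit A b : 0 < A ->
  `|gauss_fourier A b - Num.sqrt pi / 2 * expR (- (b ^+ 2 / 4))| <= 1 / A.
Proof.
move=> A0; apply/ler_addgt0Pr => e e0.
have sp : 0 < Num.sqrt pi :> R by rewrite sqrtr_gt0 pi_gt0.
have e2 : 0 < Num.sqrt pi / 2 * (e / 2) :> R by rewrite mulr_gt0 ?divr_gt0.
have /cvgrPdist_le /(_ _ e2) [M [_ HM]] := @gauss_integral_proof.cvg_integral0_gauss_sqr R.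
(* A far cutoff: beyond [M] the Gaussian integral is close to its limit, and the last entry makes
   the boundary term at [B] at most e/2. *)
pose B := Num.max A (Num.max (M + 1) (`|b| / (e / 2))).
have AB : A <= B by rewrite le_max lexx.
have B0 : 0 < B by exact: lt_le_trans AB.
have MB : M < B.
  by apply: lt_le_trans (_ : M + 1 <= _); rewrite ?ltrDl // !le_max lexx !orbT.
have bB : `|b| <= B * (e / 2).
  by rewrite -ler_pdivrMr ?divr_gt0 // !le_max lexx !orbT.
have I0 : gauss_fourier B 0 = gauss_integral_proof.integral0_gauss B.
  rewrite /gauss_fourier /integral_on /gauss_integral_proof.integral0_gauss; congr Rintegral.
  by apply/funext => x; rewrite mul0r cos0 mul1r.
have := HM B MB; rewrite /= -I0 => h1.
have F0 : 0 <= gauss_fourier B 0 by rewrite I0 gauss_integral_proof.integral0_gauss_ge0.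
have h2 : `|gauss_fourier B 0 - Num.sqrt pi / 2| <= e / 2.
  (* The known limit is that of the square, pi/4. Dividing by a sum which is at least sqrt(pi)/2
     explains the tolerance [e2]. *)
  rewrite -(ler_pM2l (_ : 0 < Num.sqrt pi / 2 + gauss_fourier B 0)); last first.
    by rewrite ltr_pwDl // divr_gt0.
  rewrite -{1}(ger0_norm (_ : 0 <= Num.sqrt pi / 2 + gauss_fourier B 0)); last first.
    by rewrite addr_ge0 // divr_ge0 // ltW.
  rewrite -normrM -[X in `|X|]opprK normrN.
  rewrite (_ : - _ = pi / 4 - gauss_fourier B 0 ^+ 2); last first.
    rewrite -[in RHS](sqr_sqrtr (pi_ge0 R)); by field.
  by apply: le_trans h1 _; rewrite ler_wpM2r ?lerDl // divr_ge0 // ltW.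
have h3 : `|b| * expR (- B ^+ 2) <= e / 2.
  apply: le_trans (_ : B * (e / 2) * expR (- B ^+ 2) <= _).
    by rewrite ler_wpM2r ?expR_ge0.
  rewrite mulrAC ler_piMl ?divr_ge0 ?(ltW e0) //.
  rewrite expRN ler_pdivrMr ?expR_gt0 // mul1r; apply: le_trans (expR_ge1Dx _).
  nra.
have h4 := gauss_fourier_decay b (ltW B0).
have h5 := gauss_fourier_tail b A0 AB.
have ge : expR (- (b ^+ 2 / 4)) <= 1 by rewrite expR_le1 oppr_le0 divr_ge0 ?sqr_ge0.
have h6 : `|(gauss_fourier B 0 - Num.sqrt pi / 2) * expR (- (b ^+ 2 / 4))| <= e / 2.
  by rewrite normrM (ger0_norm (expR_ge0 _)) (le_trans _ h2) // ler_piMr.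
move: h3 h4 h5 h6 ge; rewrite distrC.
move: (gauss_fourier A b) (gauss_fourier B b) (gauss_fourier B 0) => x y z.
move: (expR _) (Num.sqrt pi / 2) (`|b| * _) (1 / A) => g s t u.
rewrite !ler_norml => h3 /andP[? ?] /andP[? ?] /andP[? ?] ge; apply/andP; split; lra.
Qed.

End GaussianFourier.

(** * Mean and variance *)

Section Moments.
Context {R : realFieldType} {m : nat}.
Implicit Types (w : seq 'I_m) (n : nat) (a b : 'I_m).
Hypothesis m_ge2 : (2 <= m)%N.

Let m_gt0 : (0 < m)%N.
Proof. exact: ltnW. Qed.

Let m_neq0 : (m%:R : R) != 0.
Proof. by rewrite pnatr_eq0 -lt0n. Qed.

Let M : R := m%:R.

Lemma sum_const_ord (c : R) : \sum_(a < m) c = M * c.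
Proof. by rewrite sumr_const card_ord [RHS]mulr_natl. Qed.

Lemma sum_ord_natr : \sum_(a < m) (a%:R : R) = M * (M - 1) / 2.
Proof.
rewrite /M; elim: (m) => [|k IHk]; first by rewrite big_ord0 !mul0r.
by rewrite big_ord_recr /= IHk -[k.+1%:R]natr1; field.
Qed.

Lemma sum_ord_sqr : \sum_(a < m) (a%:R ^+ 2 : R) = M * (M - 1) * (2 * M - 1) / 6.
Proof.
rewrite /M; elim: (m) => [|k IHk]; first by rewrite big_ord0 !mul0r.
by rewrite big_ord_recr /= IHk -[k.+1%:R]natr1; field.
Qed.

Lemma sum_ltn_ord k : (k <= m)%N -> \sum_(b < m) ((b < k)%N : nat)%:R = k%:R :> R.
Proof.
move=> km; rewrite -natr_sum; congr (_%:R).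
rewrite -[RHS](card_ord k) -sum1_card (big_ord_widen m (fun=> 1%N) km).
by rewrite [RHS]big_mkcond; apply: eq_bigr => b _; case: (b < k)%N.
Qed.

Lemma sum_quadratic (c0 c1 c2 : R) :
  \sum_(a < m) (c0 + c1 * a%:R + c2 * a%:R ^+ 2) =
  M * c0 + c1 * (M * (M - 1) / 2) + c2 * (M * (M - 1) * (2 * M - 1) / 6).
Proof.
by rewrite !big_split /= sum_const_ord -!mulr_sumr sum_ord_natr sum_ord_sqr.
Qed.

(** Each letter counts the letters larger than itself. This is the number of inversions created by
    prepending a letter, summed over all m choices of it. *)
Definition larger_total w : R := \sum_(b <- w) (M - 1 - b%:R).

Lemma sum_smaller w : \sum_(a < m) (smaller a w)%:R = larger_total w.
Proof.
elim: w => [|b w IHw]; first by rewrite /larger_total big_nil big1.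
rewrite /larger_total big_cons -/(larger_total w) -IHw.
under eq_bigr do rewrite /smaller /= natrD -/(smaller _ w).
rewrite big_split /=; congr (_ + _).
have -> : \sum_(a < m) ((b < a)%N : nat)%:R = \sum_(a < m) (1 - ((a < b.+1)%N : nat)%:R) :> R.
  by apply: eq_bigr => a _; rewrite ltnS ltnNge; case: (a <= b)%N; rewrite ?subrr ?subr0.
rewrite sumrB sum_const_ord sum_ltn_ord // -natr1 -/M; ring.
Qed.

Lemma average_smaller n a : average n (fun w => (smaller a w)%:R) = n%:R * a%:R / M.
Proof.
elim: n => [|n IHn]; first by rewrite average0 !mul0r.
rewrite averageS (eq_bigr (fun b : 'I_m => (b < a)%N%:R + n%:R * a%:R / M)); last first.
  move=> b _; rewrite /smaller /=; under eq_average do rewrite natrD.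
  by rewrite averageD average_cst // IHn.
rewrite big_split /= !sum_const_ord -/M.
rewrite sum_ltn_ord; last exact: ltnW.
by rewrite -natr1; field.
Qed.

(** Second moment of the binomial law with parameters n and a/M. *)
Lemma average_smaller_sqr n a : average n (fun w => (smaller a w)%:R ^+ 2) =
  n%:R * (a%:R / M) + n%:R * (n%:R - 1) * (a%:R / M) ^+ 2.
Proof.
elim: n => [|n IHn]; first by rewrite average0 expr0n !mul0r addr0.
rewrite averageS (eq_bigr (fun b : 'I_m => (b < a)%N%:R * (1 + 2 * (n%:R * a%:R / M)) +
   (n%:R * (a%:R / M) + n%:R * (n%:R - 1) * (a%:R / M) ^+ 2))); last first.
  move=> b _; pose c : R := ((b < a)%N : nat)%:R.
  transitivity (average n (fun w => c + 2 * c * (smaller a w)%:R + (smaller a w)%:R ^+ 2)).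
    apply: eq_average => w _; rewrite /smaller /= natrD -/(smaller a w) /c.
    by case: (b < a)%N; rewrite /=; ring.
  by rewrite !averageD averageZ average_cst // average_smaller IHn /c; ring.
rewrite big_split /= !sum_const_ord -/M -mulr_suml.
rewrite sum_ltn_ord; last exact: ltnW.
by rewrite -natr1; field.
Qed.

Lemma average_larger_total n : average n larger_total = n%:R * (M - 1) / 2.
Proof.
rewrite -(eq_average (F1 := fun w => \sum_(a < m) (smaller a w)%:R)); last first.
  by move=> w _; exact: sum_smaller.
rewrite average_sum; under eq_bigr do rewrite average_smaller.
by rewrite -mulr_suml -mulr_sumr sum_ord_natr; field.
Qed.

(** Variance plus squared mean, for a sum of n independent uniform variables on 0, ..., m - 1. *)
Lemma average_larger_total_sqr n : average n (fun w => larger_total w ^+ 2) =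
  n%:R * (M ^+ 2 - 1) / 12 + n%:R ^+ 2 * (M - 1) ^+ 2 / 4.
Proof.
elim: n => [|n IHn].
  by rewrite average0 /larger_total big_nil expr0n !mul0r addr0.
pose K := n%:R * (M - 1).
pose L := n%:R * (M ^+ 2 - 1) / 12 + n%:R ^+ 2 * (M - 1) ^+ 2 / 4.
rewrite averageS (eq_bigr (fun a : 'I_m => ((M - 1) ^+ 2 + (M - 1) * K + L)
    + (- (2 * (M - 1)) - K) * a%:R + 1 * a%:R ^+ 2)); last first.
  move=> a _; transitivity (average n (fun w => (M - 1 - a%:R) ^+ 2 +
      2 * (M - 1 - a%:R) * larger_total w + larger_total w ^+ 2)).
    by apply: eq_average => w _; rewrite /larger_total big_cons -/(larger_total w); ring.
  by rewrite !averageD averageZ average_cst // average_larger_total IHn /K /L; field.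
by rewrite sum_quadratic /K /L -/M -natr1; field.
Qed.

Lemma average_inversions n :
  average n (fun w => (inversions w)%:R) = n%:R * (n%:R - 1) / 4 * ((M - 1) / M).
Proof.
elim: n => [|n IHn]; first by rewrite average0 !mul0r.
rewrite averageS -average_sum.
rewrite (eq_average (F2 := fun w => larger_total w + (inversions w)%:R * M)); last first.
  move=> w _; under eq_bigr do rewrite /= natrD.
  by rewrite big_split /= sum_smaller sum_const_ord mulrC.
rewrite averageD averageZr IHn average_larger_total -/M -natr1.
by field.
Qed.

(** In the recursion over the first letter, the increment from length k to k + 1 is a combination of
    k and k(k - 1), whose sums over k < n are the two polynomials in n. This mixed moment is the
    cross term in the second moment of the inversions. *)
Lemma average_larger_total_inversions n :
  average n (fun w => larger_total w * (inversions w)%:R) =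
  ((M - 1) * (M - 2) / (6 * M) + (M ^+ 2 - 1) / (12 * M) + (M - 1) ^+ 2 / (4 * M))
    * (n%:R * (n%:R - 1) / 2)
  + 3 * (M - 1) ^+ 2 / (8 * M) * (n%:R * (n%:R - 1) * (n%:R - 2) / 3).
Proof.
elim: n => [|n IHn]; first by rewrite average0 /larger_total big_nil !mul0r !mulr0 addr0.
pose e : R := average n (fun w => (inversions w)%:R).
pose K : R := average n (fun w => larger_total w * (inversions w)%:R).
rewrite averageS (eq_bigr (fun a : 'I_m =>
   ((M - 1) * e + ((M - 1) * (n%:R / M) - e) * a%:R + - (n%:R / M) * a%:R ^+ 2) +
   average n (fun w => larger_total w * (smaller a w)%:R) + K)); last first.
  move=> a _; transitivity (average n (fun w => (M - 1 - a%:R) * (smaller a w)%:R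
      + (M - 1 - a%:R) * (inversions w)%:R + larger_total w * (smaller a w)%:R
      + larger_total w * (inversions w)%:R)).
    apply: eq_average => w _ /=.
    by rewrite /larger_total big_cons -/(larger_total w) natrD; ring.
  by rewrite !averageD !averageZ average_smaller -/e -/K; ring.
rewrite 2!big_split /= sum_quadratic -average_sum sum_const_ord.
rewrite (eq_average (F2 := fun w => larger_total w ^+ 2)); last first.
  by move=> w _; rewrite -mulr_sumr sum_smaller expr2.
by rewrite average_larger_total_sqr /K IHn /e average_inversions -/M -natr1; field.
Qed.

Lemma average_inversions_sqr n :
  average n (fun w => (inversions w)%:R ^+ 2) =
  (n%:R * (n%:R - 1) / 4 * ((M - 1) / M)) ^+ 2 +
  n%:R * (n%:R - 1) * (2 * n%:R + 5) / 72 * ((M ^+ 2 - 1) / M ^+ 2).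
Proof.
elim: n => [|n IHn]; first by rewrite average0 !mul0r !expr0n addr0.
pose K : R := average n (fun w => (inversions w)%:R ^+ 2).
rewrite averageS (eq_bigr (fun a : 'I_m =>
   (0 + n%:R / M * a%:R + n%:R * (n%:R - 1) / M ^+ 2 * a%:R ^+ 2) +
   average n (fun w => 2 * (inversions w)%:R * (smaller a w)%:R) + K)); last first.
  move=> a _; transitivity (average n (fun w => (smaller a w)%:R ^+ 2
      + 2 * (inversions w)%:R * (smaller a w)%:R + (inversions w)%:R ^+ 2) : R).
    by apply: eq_average => w _ /=; rewrite natrD; ring.
  by rewrite !averageD average_smaller_sqr -/K; field.
rewrite 2!big_split /= sum_quadratic -average_sum sum_const_ord.
rewrite (eq_average (F2 := fun w => 2 * (larger_total w * (inversions w)%:R))); last first.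
  by move=> w _; rewrite -mulr_sumr sum_smaller; ring.
by rewrite averageZ average_larger_total_inversions /K IHn -/M -natr1; field.
Qed.

End Moments.

(** * Fourier inversion and the local limit *)

Section Distribution.
Context {R : realType} (n m : nat).
Hypothesis m_ge2 : (2 <= m)%N.

Let g : {poly R} := (m%:R ^- n) *: galois_poly R n m.

Lemma coef_galois_pgf j :
  g`_j = average n (fun w : seq 'I_m => (inversions w == j)%:R).
Proof.
rewrite /g coefZ galois_polyE coef_sum; congr (_ * _); apply: eq_bigr => w _.
by rewrite coefXn eq_sym.
Qed.

Lemma sum_coef_galois_pgf (f : nat -> R) :
  \sum_(j < size g) f j * g`_j = average n (fun w : seq 'I_m => f (inversions w)).
Proof.
under eq_bigr do rewrite coef_galois_pgf -averageZ.
rewrite -average_sum; congr (_ * _); apply: eq_big_seq => w ww.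
(* The coefficient at [inversions w] is a positive multiple of a sum of indicators to which [w]
   itself contributes, so it is nonzero. *)
have lt : (inversions w < size g)%N.
  rewrite ltnNge; apply/negP => /(nth_default 0)/eqP; rewrite coef_galois_pgf.
  rewrite mulf_eq0 invr_eq0 expf_eq0 pnatr_eq0 (gtn_eqF (ltnW m_ge2)) andbF /=.
  rewrite psumr_eq0 => [/allP /(_ w ww)|v _]; last exact: ler0n.
  by rewrite eqxx oner_eq0.
rewrite (bigD1 (Ordinal lt)) //= eqxx mulr1 big1 ?addr0 // => j jw.
have [e|_] := eqVneq (inversions w) j; last by rewrite mulr0.
by move/eqP: jw; case; apply/val_inj.
Qed.

End Distribution.

Section FourierInversion.
Context {R : realType}.

Lemma sin_pi_int (z : int) : sin (pi * z%:~R) = 0 :> R.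
Proof.
have sn k : sin (pi * k%:R) = 0 :> R.
  elim: k => [|k IHk]; first by rewrite mulr0 sin0.
  by rewrite -natr1 mulrDr mulr1 sinD IHk sinpi mul0r mulr0 addr0.
by case: z => k; rewrite ?NegzE ?mulrNz ?mulrN ?sinN sn ?oppr0.
Qed.

Lemma integral_cos_int (c : R) (z : int) : 0 < c ->
  c / pi * integral_on (fun x => cos (c * z%:~R * x)) 0 (pi / c) = (z == 0)%:R.
Proof.
move=> c0; have p0 := @pi_gt0 R.
have pc : 0 <= pi / c by rewrite divr_ge0 // ltW.
have [->|z0] := eqVneq z 0.
  have -> : (fun x : R => cos (c * 0%:~R * x)) = (fun=> 1).
    by apply/funext => x; rewrite mulr0 mul0r cos0.
  rewrite integral_on_cst // mul1r subr0 -[RHS]/(1 : R).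
  have p0' := lt0r_neq0 p0; have c0' := lt0r_neq0 c0.
  by rewrite mulrA divfK // divff.
have z0R : z%:~R != 0 :> R by rewrite intr_eq0.
have c0' : c != 0 by rewrite gt_eqF.
have dF (x : R) : is_derive x 1 (fun x => sin (c * z%:~R * x) * (c * z%:~R)^-1)
    (cos (c * z%:~R * x)).
  by derive; rewrite /=; field; rewrite z0R.
rewrite (integral_on_FTC _ pc dF); last by apply: is_derive_continuous => x; derive.
rewrite mulr0 sin0 mul0r subr0 (_ : c * z%:~R * (pi / c) = pi * z%:~R); last by field.
by rewrite sin_pi_int mul0r mulr0.
Qed.

Lemma integral_on_sum (I : Type) (r : seq I) (F : I -> R -> R) (a b : R) :
  (forall i, continuous (F i)) ->
  continuous (fun x => \sum_(i <- r) F i x) /\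
  integral_on (fun x => \sum_(i <- r) F i x) a b = \sum_(i <- r) integral_on (F i) a b.
Proof.
move=> cF; elim: r => [|i r [cr IHr]].
  have -> : (fun x : R => \sum_(i <- [::]) F i x) = (fun=> 0).
    by apply/funext => x; rewrite big_nil.
  split; first exact: cst_continuous.
  by rewrite big_nil /integral_on /Rintegral integral0.
have -> : (fun x => \sum_(j <- i :: r) F j x) = (fun x => F i x + \sum_(j <- r) F j x).
  by apply/funext => x; rewrite big_cons.
split; last by rewrite integral_onD // IHr big_cons.
by move=> x; apply: cvgD; [exact: cF | exact: cr].
Qed.

(** The real part of exp(-itk) times the characteristic function, at t = c x. A real part needs only
    half a period; the form 2 (c x / 2) matches the bounds at 2x. *)
Definition scaled_character (n m : nat) (k : int) (c x : R) : R :=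
  average n (fun w : seq 'I_m =>
    cos (2 * (c * x / 2) * (inversions w)%:R + - (c * k%:~R * x))).

Lemma scaled_character_inversion n m k c : 0 < c ->
  continuous (scaled_character n m k c) /\
  average n (fun w : seq 'I_m => ((inversions w)%:Z == k)%:R) =
  c / pi * integral_on (scaled_character n m k c) 0 (pi / c).
Proof.
move=> c0.
pose F (w : seq 'I_m) (x : R) := m%:R ^- n * cos (c * ((inversions w)%:Z - k)%:~R * x).
have cc (w : seq 'I_m) :
    continuous (fun x : R => cos (c * ((inversions w)%:Z - k)%:~R * x)).
  by apply: is_derive_continuous => x; derive.
have cF w : continuous (F w) by apply: is_derive_continuous => x; rewrite /F; derive.
have -> : scaled_character n m k c = (fun x => \sum_(w <- words m n) F w x).
  apply/funext => x; rewrite /scaled_character /average mulr_sumr.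
  apply: eq_bigr => w _; congr (_ * cos _).
  by rewrite intrB /= -[(inversions w)%:~R]/((inversions w)%:R); field.
have [cS ->] := integral_on_sum (words m n) 0 (pi / c) cF.
split=> //; rewrite /average !mulr_sumr; apply: eq_bigr => w _.
by rewrite integral_onZ // mulrCA integral_cos_int // subr_eq0.
Qed.

End FourierInversion.

Lemma gauss_scale_le {R : realType} (n : nat) (s : R) : 0 < n%:R :> R ->
  n%:R ^+ 3 / 96 <= s -> (Num.sqrt (2 / s) * n%:R) ^+ 2 * n%:R <= 192.
Proof.
move=> n0 s_ge.
have s0 : 0 < s by apply: lt_le_trans s_ge; rewrite divr_gt0 // exprn_gt0.
rewrite exprMn sqr_sqrtr ?divr_ge0 ?(ltW s0) //.
rewrite (_ : _ * n%:R = 2 * n%:R ^+ 3 / s); last by field; rewrite gt_eqF.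
by rewrite ler_pdivrMr //; lra.
Qed.

(** * The local estimate for fixed n, m and k *)

Section LocalEstimate.
Context {R : realType}.
Variables (n m : nat) (k : int) (mu s A : R).
Hypotheses (n_ge2 : (2 <= n)%N) (m_ge2 : (2 <= m)%N).
Hypotheses (mu_dist : `|galois_mean_bar n m - mu| <= n%:R)
  (s_dist : `|galois_var_bar n m - s| <= n%:R ^+ 2).
(** A factor 2 of margin around the range of [galois_var_bar], from n^3/48 to n^3/36. *)
Hypotheses (s_ge : n%:R ^+ 3 / 96 <= s) (s_le : s <= n%:R ^+ 3 / 18).

(* With t = c x the limiting characteristic function exp(- s t ^ 2 / 2) is
   exp(- x ^ 2), so that no change of variables is needed. *)
Let c : R := Num.sqrt (2 / s).

(** [A] ends the Gaussian range. As c n is of order n^(-1/2), [A] can be fixed first and the second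
    inequality then holds for large n. *)
Hypotheses (A_ge1 : 1 <= A) (A_le : A * (c * n%:R) <= 1).

Let b : R := c * (mu - k%:~R).
Let psi : R -> R := scaled_character n m k c.

Let n_gt0 : 0 < n%:R :> R.
Proof. by rewrite ltr0n ltnW. Qed.

Let s_gt0 : 0 < s.
Proof. by apply: lt_le_trans s_ge; rewrite divr_gt0 // exprn_gt0. Qed.

Let c_gt0 : 0 < c.
Proof. by rewrite sqrtr_gt0 divr_gt0. Qed.

Let c_sqr : c ^+ 2 = 2 / s.
Proof. by rewrite sqr_sqrtr // divr_ge0 // ltW. Qed.

Let c_sqr_le : (c * n%:R) ^+ 2 * n%:R <= 192.
Proof. exact: gauss_scale_le. Qed.

Let c_sqr_ge : 36 <= c ^+ 2 * n%:R ^+ 3.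
Proof.
rewrite c_sqr (_ : 2 / s * n%:R ^+ 3 = 2 * n%:R ^+ 3 / s); last by ring.
by rewrite ler_pdivlMr //; have := s_le; lra.
Qed.

Let A_gt0 : 0 < A.
Proof. exact: lt_le_trans A_ge1. Qed.

(** With z = c n, every error is a multiple of z A^4; the multiples 12, 1/4, 1/2, 1 and 1/2 add up
    to less than 18. *)
Lemma character_central x : 0 < x -> x <= A ->
  `|psi x - cos (b * x) * expR (- x ^+ 2)| <= 18 * (c * n%:R) * A ^+ 4.
Proof.
move=> x0 xA; pose y := c * x / 2; have y0 : 0 < y by rewrite divr_gt0 // mulr_gt0.
pose z := c * n%:R; have z0 : 0 < z by rewrite mulr_gt0.
have ny : n%:R * y <= z * A / 2.
  rewrite /y /z (_ : n%:R * _ = c * n%:R * x / 2); last by ring.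
  by rewrite ler_pM2r ?invr_gt0 // ler_pM2l.
have zA : z * A <= 1 by rewrite mulrC.
have nypi : n%:R * y < pi by have := @pi_ge2 R; lra.
pose theta := - (c * k%:~R * x).
have h1 := cosine_gaussian_bar m_ge2 theta (ltnW n_ge2) y0 nypi.
have h2 := gaussian_dist theta (galois_mean_bar n m) mu (ltW y0)
  (galois_var_bar_ge0 m_ge2 n) (ltW s_gt0).
have e1 : cos (2 * y * mu + theta) = cos (b * x).
  by congr cos; rewrite /y /theta /b; field.
have e2 : 2 * y ^+ 2 * s = x ^+ 2.
  rewrite /y (_ : _ * s = c ^+ 2 * s * x ^+ 2 / 2); last by field.
  by rewrite c_sqr; field; rewrite gt_eqF.
rewrite e1 e2 in h2.
have nz : n%:R * z ^+ 2 <= 192 by rewrite mulrC; exact: c_sqr_le.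
have ny0 : 0 < n%:R * y by rewrite mulr_gt0.
have q2 : (n%:R * y) ^+ 2 <= (z * A / 2) ^+ 2.
  by rewrite lerXn2r ?nnegrE // ltW // (lt_le_trans ny0).
have q4 : (n%:R * y) ^+ 4 <= (z * A / 2) ^+ 4.
  by rewrite lerXn2r ?nnegrE // ltW // (lt_le_trans ny0).
(* Of n (n y)^4, a factor n z^2 <= 192 is split off, and 192/16 = 12. *)
have r5 : n%:R ^+ 5 * y ^+ 4 <= 12 * z ^+ 2 * A ^+ 4.
  rewrite (_ : _ * _ = n%:R * (n%:R * y) ^+ 4); last by ring.
  apply: le_trans (_ : n%:R * (z * A / 2) ^+ 4 <= _); first by rewrite ler_pM2l.
  rewrite (_ : _ * _ ^+ 4 = n%:R * z ^+ 2 * (z ^+ 2 * A ^+ 4 / 16)); last by field.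
  rewrite (_ : 12 * _ * _ = 192 * (z ^+ 2 * A ^+ 4 / 16)); last by field.
  by rewrite ler_wpM2r // divr_ge0 // mulr_ge0 ?sqr_ge0 // exprn_ge0 // ltW.
have hmu : 2 * y * `|galois_mean_bar n m - mu| <= 2 * (n%:R * y).
  rewrite (_ : 2 * (n%:R * y) = 2 * y * n%:R); last by ring.
  by rewrite ler_wpM2l // mulr_ge0 // ltW.
have hs : 2 * y ^+ 2 * `|galois_var_bar n m - s| <= 2 * (n%:R * y) ^+ 2.
  rewrite (_ : 2 * (n%:R * y) ^+ 2 = 2 * y ^+ 2 * n%:R ^+ 2); last by ring.
  by rewrite ler_wpM2l // mulr_ge0 // sqr_ge0.
rewrite (_ : n%:R ^+ 2 * y ^+ 2 = (n%:R * y) ^+ 2) in h1; last by ring.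
have A4 : A <= A ^+ 4 by rewrite -[X in X <= _]expr1 ler_weXn2l.
have A24 : A ^+ 2 <= A ^+ 4 by rewrite ler_weXn2l.
have z1 : z <= 1 by apply: le_trans zA; rewrite ler_peMr // ltW.
have zz : z ^+ 2 <= z by rewrite expr2 ler_piMr // ltW.
have A40 : 0 <= A ^+ 4 by rewrite exprn_ge0 // ltW.
have t1 : z ^+ 2 * A ^+ 4 <= z * A ^+ 4 by rewrite ler_wpM2r.
have t2 : (z * A / 2) ^+ 2 <= z * A ^+ 4 / 4.
  rewrite (_ : _ ^+ 2 = z ^+ 2 * A ^+ 2 / 4); last by field.
  by rewrite ler_pM2r ?invr_gt0 // ler_pM ?sqr_ge0.
have t3 : z * A <= z * A ^+ 4 by rewrite ler_pM2l.
rewrite -/z -[18 * z * _]mulrA; rewrite -[12 * _ * _]mulrA in r5.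
rewrite /psi /scaled_character -/y -/theta.
move: h1 h2 r5 hmu hs q2 t1 t2 t3 ny.
set X := average _ _; set Y := cos (2 * y * _ + theta) * _; set Z := cos (b * x) * _.
rewrite !ler_norml => /andP[? ?] /andP[? ?] r5 hmu hs q2 t1 t2 t3 ny.
by apply/andP; split; lra.
Qed.

Lemma character_near x : 0 < x -> x * (c * n%:R) <= 1 ->
  `|psi x| <= expR (- (x ^+ 2 / 24)).
Proof.
move=> x0 xD; have y0 : 0 < c * x / 2 by rewrite divr_gt0 // mulr_gt0.
have ny : n%:R * (c * x / 2) <= 1 / 2.
  by rewrite (_ : _ * _ = x * (c * n%:R) / 2); [lra | ring].
apply: le_trans (cosine_bound_near m_ge2 n_ge2 y0 ny (fun=> - (c * k%:~R * x))) _.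
rewrite ler_expR lerN2.
rewrite (_ : _ * _ / 216 = c ^+ 2 * n%:R ^+ 3 * x ^+ 2 / 864); last by field.
have : 0 <= x ^+ 2 by exact: sqr_ge0.
by move: c_sqr_ge; nra.
Qed.

Lemma character_far x : 0 < x -> c * x < pi -> 1 <= x * (c * n%:R) ->
  `|psi x| <= pair_rate (1 / 72) ^+ (n %/ 6).
Proof.
move=> x0 xpi xD; have y0 : 0 < c * x / 2 by rewrite divr_gt0 // mulr_gt0.
apply: (cosine_bound_far m_ge2 n_ge2 y0 _ _ (fun=> - (c * k%:~R * x))).
  by rewrite ltr_pM2r ?invr_gt0.
by rewrite (_ : n%:R * _ = x * (c * n%:R) / 2); [lra | ring].
Qed.

Lemma integral_gauss_tail B : A <= B ->
  integral_on (fun x => expR (- (x ^+ 2 / 24))) A B <= 24 / A.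
Proof.
move=> AB.
have c1 : continuous (fun x : R => expR (- (x ^+ 2 / 24))).
  by apply: is_derive_continuous => x; derive.
have c2 : continuous (fun x : R => expR (- (A * x / 24))).
  by apply: is_derive_continuous => x; derive.
apply: le_trans (ler_norm _) _.
apply: le_trans (norm_integral_on_le c1 c2 AB _) _.
  move=> x Ax xB; rewrite ger0_norm ?expR_ge0 // ler_expR lerN2 ler_pM2r ?invr_gt0 //.
  by rewrite expr2 ler_pM2r ?ltW // (lt_trans A_gt0).
have dE (x : R) : is_derive x 1 (fun x => - (24 * A^-1 * expR (- (A * x / 24))))
    (expR (- (A * x / 24))).
  by derive; rewrite /=; field; rewrite gt_eqF.
rewrite (integral_on_FTC c2 AB dE) opprK.
have eA : expR (- (A * A / 24)) <= 1 by rewrite expR_le1 oppr_le0 divr_ge0 // mulr_ge0 // ltW.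
have := expR_ge0 (- (A * B / 24)); have iA : 0 < A^-1 by rewrite invr_gt0.
nra.
Qed.

Lemma local_estimate :
  `| Num.sqrt s * average n (fun w : seq 'I_m => ((inversions w)%:Z == k)%:R)
     - (Num.sqrt (2 * pi))^-1 * expR (- (k%:~R - mu) ^+ 2 / (2 * s)) | <=
  18 * (c * n%:R) * A ^+ 5 + 25 / A + 4 * n%:R ^+ 2 * pair_rate (1 / 72) ^+ (n %/ 6).
Proof.
have [cpsi ->] := scaled_character_inversion n m k c_gt0; rewrite -/psi.
have p0 := @pi_gt0 R; have p2 := @pi_ge2 R.
have ss : 0 < Num.sqrt s by rewrite sqrtr_gt0.
have s2 : 0 < Num.sqrt 2 :> R by rewrite sqrtr_gt0.
have sp : 0 < Num.sqrt pi :> R by rewrite sqrtr_gt0.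
have cE : c = Num.sqrt 2 / Num.sqrt s.
  by rewrite /c sqrtrM // sqrtrV // ltW.
pose I := integral_on psi 0 (pi / c).
pose L : R := Num.sqrt pi / 2 * expR (- (b ^+ 2 / 4)).
(* Here sqrt(s) c = sqrt(2), and 1/sqrt(2 pi) is sqrt(2)/pi times the Gaussian mass sqrt(pi)/2 on
   the half-line. *)
have -> : Num.sqrt s * (c / pi * integral_on psi 0 (pi / c)) -
    (Num.sqrt (2 * pi))^-1 * expR (- (k%:~R - mu) ^+ 2 / (2 * s)) =
    Num.sqrt 2 / pi * (I - L).
  have -> : - (k%:~R - mu) ^+ 2 / (2 * s) = - (b ^+ 2 / 4).
    by rewrite /b exprMn c_sqr; field; rewrite gt_eqF.
  have aux (a q : R) : a != 0 -> q != 0 -> a ^+ 2 = 2 -> (a * q)^-1 = a / q ^+ 2 * (q / 2).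
    by move=> a0 q0 <-; field; rewrite a0.
  have := aux (Num.sqrt 2) (Num.sqrt pi) (lt0r_neq0 s2) (lt0r_neq0 sp).
  rewrite !sqr_sqrtr ?(ltW p0) // => /(_ erefl) e; rewrite /L sqrtrM // e -/I.
  have sc : Num.sqrt s * c = Num.sqrt 2 by rewrite cE; field; rewrite gt_eqF.
  by rewrite !mulrA sc; ring.
have s2p : Num.sqrt 2 / pi <= 1 :> R.
  rewrite ler_pdivrMr // mul1r; apply: le_trans p2.
  by rewrite -[X in _ <= X](@ger0_norm R) // -sqrtr_sqr ler_sqrt // expr2; lra.
apply: le_trans (_ : `|I - L| <= _).
  by rewrite normrM ler_piMl // ger0_norm // divr_ge0 // ltW.
(* At x = [D] one has n (c x / 2) = 1/2, where the near bound hands over to the far one. *)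
pose D := (c * n%:R)^-1.
have cn : 0 < c * n%:R by rewrite mulr_gt0.
have AD : A <= D by rewrite -[D]mul1r ler_pdivlMr.
have D0 : 0 < D by rewrite invr_gt0.
have Dpi : D <= pi / c.
  rewrite /D invfM mulrC ler_pM2r ?invr_gt0 //; apply: le_trans (_ : 1 <= _); last lra.
  by rewrite invf_le1 // ler1n ltnW.
have IE : I = integral_on psi 0 A + integral_on psi A D + integral_on psi D (pi / c).
  by rewrite /I (integral_on_split cpsi (ltW D0) Dpi) (integral_on_split cpsi (ltW A_gt0) AD).
have cg := @continuous_cos_gauss R b.
have k1 : `|integral_on psi 0 A - gauss_fourier A b| <= 18 * (c * n%:R) * A ^+ 5.
  rewrite /gauss_fourier -integral_onB //.
  rewrite (_ : 18 * _ * _ = integral_on (fun=> 18 * (c * n%:R) * A ^+ 4) 0 A); last first.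
    by rewrite integral_on_cst ?subr0 1?ltW // (exprSr A 4) mulrA.
  apply: norm_integral_on_le; rewrite ?(ltW A_gt0) //.
    by move=> x; apply: cvgB; [exact: cpsi | exact: cg].
    exact: cst_continuous.
  by move=> x x0 xA; apply: character_central => //; exact: ltW.
have k2 : `|integral_on psi A D| <= 24 / A.
  apply: le_trans (integral_gauss_tail AD).
  apply: norm_integral_on_le => //.
    by apply: is_derive_continuous => x; derive.
  move=> x Ax xD; apply: character_near; first exact: lt_trans Ax.
  by rewrite -ler_pdivlMr // mul1r ltW.
have k3 : `|integral_on psi D (pi / c)| <= 4 * n%:R ^+ 2 * pair_rate (1 / 72) ^+ (n %/ 6).
  have r0 : 0 <= pair_rate (1 / 72 : R) ^+ (n %/ 6) by rewrite exprn_ge0 // pair_rate_ge0.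
  apply: le_trans (_ : integral_on (fun=> pair_rate (1 / 72) ^+ (n %/ 6)) D (pi / c) <= _).
    apply: norm_integral_on_le => //; first exact: cst_continuous.
    move=> x Dx xpi; apply: character_far; first exact: lt_trans Dx.
      by rewrite mulrC -ltr_pdivlMr.
    by rewrite -ler_pdivrMr // mul1r ltW.
  rewrite integral_on_cst // mulrC ler_wpM2r //.
  apply: le_trans (_ : pi / c <= _); first by rewrite gerBl ltW.
  rewrite ler_pdivrMr //.
  have n1 : 1 <= n%:R :> R by rewrite ler1n ltnW.
  (* This yields pi / c <= 4 n^2 for the length of the far range, a crude bound that the geometric
     factor absorbs. *)
  have cn2 : 1 <= c * n%:R ^+ 2.
    rewrite -(ler_sqr (_ : 1 \is Num.nneg)) ?nnegrE ?mulr_ge0 ?sqr_ge0 ?(ltW c_gt0) //.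
    rewrite expr1n exprMn (_ : _ * _ = c ^+ 2 * n%:R ^+ 3 * n%:R); last by ring.
    by move: c_sqr_ge; nra.
  have p4 : pi <= 4 :> R by have := @pihalf_lt2 R; lra.
  by rewrite -mulrA [_ ^+ 2 * c]mulrC; lra.
have k4 := gauss_fourier_limit b A_gt0.
rewrite -/L in k4; rewrite IE.
have -> : 25 / A = 24 / A + 1 / A by ring.
move: k1 k2 k3 k4; set x1 := integral_on psi 0 A; set x2 := integral_on psi A D.
set x3 := integral_on psi D _; set x4 := gauss_fourier A b.
rewrite !ler_norml => /andP[? ?] /andP[? ?] /andP[? ?] /andP[? ?].
by apply/andP; split; lra.
Qed.

End LocalEstimate.

(** * Choice of the cutoff, uniformly in m and k *)

Section LocalLimit.
Context {R : realType}.

Lemma sqr_mul_geometric_small (r e : R) : 0 <= r -> r < 1 -> 0 < e ->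
  exists N, forall n, (N <= n)%N -> n%:R ^+ 2 * r ^+ (n %/ 6) <= e.
Proof.
move=> r0 r1 e0; pose h := 1 - r; have h0 : 0 < h by rewrite subr_gt0.
have bernoulli j : r ^+ j * (1 + j%:R * h) <= 1.
  elim: j => [|j IHj]; first by rewrite expr0 mul0r addr0 mul1r.
  have rj : r ^+ j.+1 <= 1 by rewrite exprn_ile1 // ltW.
  rewrite -natr1 exprS; move: IHj rj; rewrite exprS /h.
  have : 0 <= r ^+ j by rewrite exprn_ge0.
  by move: (r ^+ j) (j%:R : R) => q i; nra.
pose C := 36 ^+ 3 / (e * h ^+ 3).
exists (maxn 18 (Num.bound C)) => n; rewrite geq_max => /andP[n18 nC].
have n0 : 0 < n%:R :> R by rewrite ltr0n; exact: leq_trans n18.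
have eh : 0 < e * h ^+ 3 by rewrite mulr_gt0 // exprn_gt0.
have C0 : 0 <= C by rewrite divr_ge0 // ltW.
have Cn : C <= n%:R.
  by apply: le_trans (ltW (archi_boundP C0)) _; rewrite ler_nat.
(* Bernoulli's inequality alone gives decay 1/n; cutting the exponent n %/ 6 in three gives 1/n^3,
   enough against n^2. *)
pose j := (n %/ 18)%N.
have nj : n%:R <= 36 * j%:R :> R by rewrite -natrM ler_nat /j; lia.
have rk : r ^+ (n %/ 6) <= (r ^+ j) ^+ 3.
  by rewrite -exprM ler_wiXn2l // 1?ltW // /j; lia.
have jr : n%:R * h * r ^+ j <= 36.
  have : 0 <= r ^+ j by rewrite exprn_ge0.
  move: (bernoulli j); move: (r ^+ j) => q hq q0.
  have : n%:R * (h * q) <= 36 * j%:R * (h * q) by rewrite ler_wpM2r // mulr_ge0 // ltW.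
  by rewrite mulrA; nra.
have jr0 : 0 <= n%:R * h * r ^+ j by rewrite !mulr_ge0 ?exprn_ge0 // ltW.
have jr3 : (n%:R * h * r ^+ j) ^+ 3 <= 36 ^+ 3.
  by rewrite lerXn2r ?nnegrE.
apply: le_trans (_ : n%:R ^+ 2 * (r ^+ j) ^+ 3 <= _); first by rewrite ler_wpM2l // sqr_ge0.
have nh : 0 < n%:R * h ^+ 3 by rewrite mulr_gt0 // exprn_gt0.
rewrite -(ler_pM2r nh); move: jr3; rewrite !exprMn => jr3.
rewrite (_ : _ * _ * _ = n%:R ^+ 3 * h ^+ 3 * (r ^+ j) ^+ 3); last by ring.
apply: le_trans jr3 _; move: Cn; rewrite /C ler_pdivrMr // => Cn.
by rewrite (_ : e * _ = n%:R * (e * h ^+ 3)) //; ring.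
Qed.

Lemma galois_var_bar_bounds (n m : nat) : (2 <= m)%N ->
  n%:R ^+ 3 / 48 <= galois_var_bar n m :> R /\ galois_var_bar n m <= n%:R ^+ 3 / 36 :> R.
Proof.
move=> m2; have M2 : 2 <= m%:R :> R by rewrite ler_nat.
have n3 : 0 <= n%:R ^+ 3 :> R by rewrite exprn_ge0.
have M0 : 0 < m%:R ^+ 2 :> R by rewrite exprn_gt0 // (lt_le_trans _ M2).
have -> : galois_var_bar n m = n%:R ^+ 3 / 36 * ((m%:R ^+ 2 - 1) / m%:R ^+ 2) :> R.
  by rewrite /galois_var_bar; field; rewrite lt0r_neq0 // (lt_le_trans _ M2).
have q1 : (m%:R ^+ 2 - 1) / m%:R ^+ 2 <= 1 :> R by rewrite ler_pdivrMr // mul1r gerBl.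
have q2 : 3 / 4 <= (m%:R ^+ 2 - 1) / m%:R ^+ 2 :> R.
  by rewrite ler_pdivlMr //; nra.
by move: q1 q2; move: (_ / _ ^+ 2) => q q1 q2; split; nra.
Qed.

Lemma uniform_local_limit_of (p : nat -> nat -> int -> R) (mu s : nat -> nat -> R) :
  (forall n m k, (1 <= n)%N -> (2 <= m)%N ->
     p n m k = average n (fun w : seq 'I_m => ((inversions w)%:Z == k)%:R)) ->
  (forall n m, (1 <= n)%N -> (2 <= m)%N -> `|galois_mean_bar n m - mu n m| <= n%:R) ->
  (forall n m, (1 <= n)%N -> (2 <= m)%N -> `|galois_var_bar n m - s n m| <= n%:R ^+ 2) ->
  uniform_local_limit p mu s.
Proof.
move=> pE mu_dist s_dist e e0.
(* [A] depends on [e] alone, [delta] on [e] and [A], and the bound on n comes last. Each of the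
   three error terms gets e/3. *)
pose A : R := 1 + 75 / e.
have A1 : 1 <= A by rewrite lerDl divr_ge0 // ltW.
have A0 : 0 < A by exact: lt_le_trans A1.
have Ae : 25 / A < e / 3.
  rewrite ltr_pdivrMr // /A mulrDr mulr1 (_ : e / 3 * (75 / e) = 25).
    by rewrite ltrDr divr_gt0.
  by field; rewrite lt0r_neq0.
pose delta := Num.min A^-1 (e / (54 * A ^+ 5)).
have A5 : 0 < 54 * A ^+ 5 by rewrite mulr_gt0 // exprn_gt0.
have d0 : 0 < delta by rewrite lt_min invr_gt0 A0 divr_gt0.
have dA : delta * A <= 1.
  by rewrite -ler_pdivlMr // mul1r ge_min lexx.
have de : 18 * delta * A ^+ 5 <= e / 3.
  have : delta <= e / (54 * A ^+ 5) by rewrite ge_min lexx orbT.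
  by rewrite ler_pdivlMr //; lra.
have r0 := pair_rate_ge0 (1 / 72 : R).
have r1 : pair_rate (1 / 72) < 1 :> R.
  rewrite /pair_rate ltr_pdivrMr //.
  have : expR (- (1 / 72)) < 1 :> R by rewrite -[X in _ < X]expR0 ltr_expR; lra.
  by lra.
have e12 : 0 < e / 12 by rewrite divr_gt0.
have [N1 HN1] := sqr_mul_geometric_small r0 r1 e12.
pose B := 192 / delta ^+ 2.
have d2 : 0 < delta ^+ 2 by rewrite exprn_gt0.
have B0 : 0 <= B by rewrite divr_ge0 // ltW.
(* From 96 on, n^2 <= n^3/96 keeps [s] within its margins; [N1] settles the far range and [B] forces
   c n <= delta. *)
exists (maxn 96 (maxn N1 (Num.bound B))) => n m k.
rewrite !geq_max => /andP[n96 /andP[nN1 nB]] m2.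
have n1 : (1 <= n)%N by exact: leq_trans n96.
have n2 : (2 <= n)%N by exact: leq_trans n96.
have n96R : 96 <= n%:R :> R by rewrite ler_nat.
have n0 : 0 < n%:R :> R by rewrite ltr0n.
have nn : 96 * n%:R ^+ 2 <= n%:R ^+ 3 :> R by rewrite exprS ler_wpM2r // sqr_ge0.
have [v1 v2] := galois_var_bar_bounds n m2.
have sd := s_dist n m n1 m2.
have s1 : n%:R ^+ 3 / 96 <= s n m.
  by move: sd; rewrite ler_norml => /andP[? ?]; lra.
have s2 : s n m <= n%:R ^+ 3 / 18.
  by move: sd; rewrite ler_norml => /andP[? ?]; lra.
pose z := Num.sqrt (2 / s n m) * n%:R.
have z0 : 0 <= z by rewrite mulr_ge0 ?sqrtr_ge0 // ltW.
have zd : z <= delta.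
  rewrite -(ler_pXn2r (_ : (0 < 2)%N)) ?nnegrE ?(ltW d0) //.
  rewrite -(ler_pM2r n0); apply: le_trans (gauss_scale_le n0 s1) _.
  rewrite mulrC -ler_pdivrMr // -/B.
  by apply: le_trans (ltW (archi_boundP B0)) _; rewrite ler_nat.
have Az : A * z <= 1 by rewrite mulrC; apply: le_trans dA; rewrite ler_pM2r.
rewrite pE //.
have est := local_estimate k n2 m2 (mu_dist n m n1 m2) sd s1 s2 A1 Az.
apply: le_lt_trans est _.
have h1 : 18 * z * A ^+ 5 <= e / 3.
  by apply: le_trans de; rewrite ler_pM2r ?exprn_gt0 // ler_pM2l.
have h3 := HN1 n nN1.
rewrite -/z -[4 * _ * _]mulrA.
lra.
Qed.

End LocalLimit.

(** * Law, mean and variance of the random variable *)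

Section GaloisDistribution.
Context {R : realType} d (T : measurableType d) (P : probability T R).
Variables (X : {RV P >-> nat}) (n m : nat).
Hypothesis m_ge2 : (2 <= m)%N.
Hypothesis pgfX : has_pgf X ((m%:R ^- n) *: galois_poly R n m).

Lemma galois_pmf (k : int) : fine (P [set w | (X w)%:Z = k]) =
  average n (fun w : seq 'I_m => ((inversions w)%:Z == k)%:R).
Proof.
case: k => j.
  rewrite (_ : [set w | _] = [set w | X w = j]).
    rewrite (pgf_coefficient j pgfX) coef_galois_pgf.
    by apply: eq_average => w _; rewrite eqz_nat.
  by apply/seteqP; split=> w /=; [case | move=> ->].
rewrite (_ : [set w | _] = set0); last by apply/seteqP; split.
by rewrite measure0 /= average_cst // ltnW.
Qed.

Lemma galois_expectation (f : nat -> R) : (forall j, 0 <= f j) ->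
  (\int[P]_w (f (X w))%:E = (average n (fun w : seq 'I_m => f (inversions w)))%:E)%E.
Proof.
by move=> f0; rewrite (pgf_expectation pgfX f0) sum_coef_galois_pgf.
Qed.

Lemma galois_pgf_mean : ('E_P[fun w => (X w)%:R%R] = (galois_mean n m)%:E)%E.
Proof.
rewrite expectation.unlock (galois_expectation (f := fun j => j%:R)) //.
by rewrite average_inversions.
Qed.

Lemma galois_pgf_variance : ('V_P[fun w => (X w)%:R%R] = (galois_var n m)%:E)%E.
Proof.
rewrite /variance covariance.unlock galois_pgf_mean /=.
rewrite expectation.unlock.
pose f (j : nat) : R := (j%:R - galois_mean n m) ^+ 2.
transitivity (\int[P]_w (f (X w))%:E)%E.
  by apply: eq_integral => w _; rewrite /f expr2.
rewrite galois_expectation => [|j]; last exact: sqr_ge0.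
congr (_%:E); rewrite /f.
transitivity (average n (fun w : seq 'I_m => (inversions w)%:R ^+ 2 +
   - 2 * galois_mean n m * (inversions w)%:R + galois_mean n m ^+ 2) : R).
  by apply: eq_average => w _; ring.
rewrite !averageD averageZ average_cst ?(ltnW m_ge2) // average_inversions_sqr //.
by rewrite average_inversions // -/(galois_mean n m) -/(galois_var n m); ring.
Qed.

End GaloisDistribution.

Lemma galois_mean_dist {R : realType} (n m : nat) : (2 <= m)%N ->
  `|galois_mean_bar n m - galois_mean n m| <= n%:R :> R.
Proof.
move=> m2; have M2 : 2 <= m%:R :> R by rewrite ler_nat.
have M0 : m%:R != 0 :> R by rewrite lt0r_neq0 // (lt_le_trans _ M2).
have -> : galois_mean_bar n m - galois_mean n m = n%:R * ((m%:R - 1) / m%:R / 4) :> R.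
  by rewrite /galois_mean_bar /galois_mean; field.
have q0 : 0 <= (m%:R - 1) / m%:R :> R by rewrite divr_ge0 // subr_ge0 (le_trans _ M2) // ler1n.
have q1 : (m%:R - 1) / m%:R <= 1 :> R.
  by rewrite ler_pdivrMr ?mul1r ?gerBl // (lt_le_trans _ M2).
rewrite normrM ger0_norm // ler_piMr // ger0_norm; last by rewrite divr_ge0.
by rewrite ler_pdivrMr //; lra.
Qed.

Lemma galois_var_dist {R : realType} (n m : nat) : (1 <= n)%N -> (2 <= m)%N ->
  `|galois_var_bar n m - galois_var n m| <= n%:R ^+ 2 :> R.
Proof.
move=> n1 m2; have M2 : 2 <= m%:R :> R by rewrite ler_nat.
have M0 : m%:R != 0 :> R by rewrite lt0r_neq0 // (lt_le_trans _ M2).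
have N1 : 1 <= n%:R :> R by rewrite ler1n.
pose q : R := (m%:R ^+ 2 - 1) / m%:R ^+ 2.
have -> : galois_var_bar n m - galois_var n m =
    q * ((5 * n%:R - 3 * n%:R ^+ 2) / 72) :> R.
  by rewrite /galois_var_bar /galois_var /q; field.
have q0 : 0 <= q.
  by rewrite divr_ge0 ?sqr_ge0 // subr_ge0 expr_ge1 // (le_trans _ M2) // ler1n.
have q1 : q <= 1.
  by rewrite ler_pdivrMr ?mul1r ?gerBl // exprn_gt0 // (lt_le_trans _ M2).
rewrite normrM (ger0_norm q0).
apply: le_trans (_ : 1 * `|(5 * n%:R - 3 * n%:R ^+ 2) / 72| <= _).
  by rewrite ler_wpM2r.
by rewrite mul1r ler_norml; apply/andP; split; nra.
Qed.

Theorem theorem1p5 (R : realType)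
    (d : nat -> nat -> measure_display)
    (T : forall n m : nat, measurableType (d n m))
    (P : forall n m : nat, probability (T n m) R)
    (G : forall n m : nat, {RV (P n m) >-> nat})
    (pgfG : forall n m : nat, (1 <= n)%N -> (2 <= m)%N ->
      has_pgf (G n m) ((m%:R ^- n) *: galois_poly R n m)) :
  let p (n m : nat) (k : int) : R :=
    fine (P n m [set w | (G n m w)%:Z = k]) in
  [/\ (forall n m : nat, (1 <= n)%N -> (2 <= m)%N ->
         'E_(P n m)[fun w => (G n m w)%:R%R]%E = (galois_mean n m)%:E
         /\ 'V_(P n m)[fun w => (G n m w)%:R%R]%E = (galois_var n m)%:E),
      uniform_local_limit p galois_mean galois_var
    & uniform_local_limit p galois_mean_bar galois_var_bar].
Proof.
move=> p.
have pE n m k : (1 <= n)%N -> (2 <= m)%N ->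
    p n m k = average n (fun w : seq 'I_m => ((inversions w)%:Z == k)%:R).
  by move=> n1 m2; apply: galois_pmf => //; exact: pgfG.
split.
- move=> n m n1 m2; split; first exact: galois_pgf_mean (pgfG n m n1 m2).
  exact: galois_pgf_variance (pgfG n m n1 m2).
- apply: uniform_local_limit_of pE _ _ => n m n1 m2; first exact: galois_mean_dist.
  exact: galois_var_dist.
apply: uniform_local_limit_of pE _ _ => n m n1 m2; first by rewrite subrr normr0.
by rewrite subrr normr0 sqr_ge0.
Qed.
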